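(* Consider the EVRPTWNL with a finite set $\mathcal Q$ of subset-row cuts $(S_q,w^q,\lambda_q)$, $q\in\mathcal Q$, and let $\succeq$ be the domination relations with subset-row cuts $\mathcal Q$ defined in the context. Then: (i) Let $s_1,s_2$ be feasible partial subpaths with $s_1\succeq s_2$, and let $a\in\mathcal A$ be an arc extending both. If $s_2\oplus a$ is feasible, then $s_1\oplus a$ is feasible and $s_1\oplus a\succeq s_2\oplus a$. (ii) Let $p_1,p_2$ be feasible partial paths with $p_1\succeq p_2$, and let $s$ be a feasible subpath extending both. If $p_2\oplus s$ is feasible, then $p_1\oplus s$ is feasible and $p_1\oplus s\succeq p_2\oplus s$. (iii) Let $s_1,s_2$ be feasible subpaths with $s_1\succeq s_2$, both extending a feasible partial path $p$. If $p\oplus s_2$ is feasible, then $p\oplus s_1$ is feasible and $p\oplus s_1\succeq p\oplus s_2$.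
   Context: **Instance.** $(\mathcal V,\mathcal A)$ is a finite directed graph, $\mathcal V=\mathcal V_C\cup\mathcal V_D\cup\mathcal V_S$ a partition into customers, depots and charging stations; $T$ is the time horizon, $B$ the battery capacity, $D$ the vehicle capacity. Each arc $(i,j)$ has travel time $t_{i,j}>0$, cost $c_{i,j}>0$, battery use $b_{i,j}>0$. Each node $i$ has demand $d_i\ge 0$ and time window $[\alpha_i,\beta_i]\subseteq[0,T]$; for $i\in\mathcal V_D\cup\mathcal V_S$, $d_i=0$, $\alpha_i=0$, $\beta_i=T$. The charging function $g:\mathbb R_+\to[0,B]$ is concave, increasing, $g(0)=0$, and invertible: it is continuous, strictly increasing until it attains $B$, and $g^{-1}(b)$ is the smallest $t$ with $g(t)=b$. Set $g_T(b_1,b_2)=g^{-1}(b_2)-g^{-1}(b_1)$ and $g_C(b,t)=g(g^{-1}(b)+t)$. **Subset-row cuts and reduced cost.** Each cut $q\in\mathcal Q$ has $S_q\subseteq\mathcal V_C$, nonnegative weights $w^q=(w^q_i)_{i\in S_q}$ and a dual value $\lambda_q\le0$. Given real vectors $\kappa,\mu$ (indexed by $\mathcal V_D$) and $\nu$ (indexed by $\mathcal V_C$), let $\overline c_{i,j}=c_{i,j}-\mathbb 1(i\in\mathcal V_D)\kappa_i-\mathbb 1(j\in\mathcal V_D)\mu_j-\mathbb 1(j\in\mathcal V_C)\nu_j$. For a (partial) path or subpath with node sequence $N=(n_0,\dots,n_m)$, let $\omega_q(N)=\sum_{\ell=0}^m w^q_{n_\ell}\mathbb 1(n_\ell\in S_q)$,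 $\alpha_q(N)=\omega_q(N)-\lfloor\omega_q(N)\rfloor$, and reduced cost $\overline c(N)=\sum_{\ell=0}^{m-1}\overline c_{n_\ell,n_{\ell+1}}-\sum_{q\in\mathcal Q}\lambda_q\lfloor\omega_q(N)\rfloor$. **Subpaths.** A partial subpath $s$ is a node sequence $(n_0,\dots,n_m)$ along arcs with $n_0\in\mathcal V_D\cup\mathcal V_S$ and $n_1,\dots,n_{m-1}\in\mathcal V_C$; it is a subpath if moreover $n_m\in\mathcal V_D\cup\mathcal V_S$. It is feasible if there is $(t_0,b_0)$ such that, with $t_{k+1}=\max\{t_k+t_{n_k,n_{k+1}},\alpha_{n_{k+1}}\}$ and $b_{k+1}=b_k-b_{n_k,n_{k+1}}$, one has $\sum_k d_{n_k}\le D$, $b_k\in[0,B]$, $t_k\in[\alpha_{n_k},\beta_{n_k}]$ for all $k$. An arc $a=(n_m,n')$ extends $s$ to $s\oplus a$. Further resources: $B(s)=\sum_\ell b_{n_\ell,n_{\ell+1}}$; $D(s)=\sum_{\ell=0}^m d_{n_\ell}$; $T^{\rm travel}(s)=\sum_\ell t_{n_\ell,n_{\ell+1}}$; $T^{\rm end}_{\min}(s)=T^E_m$ with $T^E_0=\alpha_{n_0}$, $T^E_{\ell+1}=\max\{T^E_\ell+t_{n_\ell,n_{\ell+1}},\alpha_{n_{\ell+1}}\}$; $T^{\rm start}_{\max}(s)=T^L_0$ with $T^L_m=\beta_{n_m}$, $T^L_\ell=\min\{T^L_{\ell+1}-t_{n_\ell,n_{\ell+1}},\beta_{n_\ell}\}$;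 $Q(s)=\max\{T^{\rm travel}(s),T^{\rm end}_{\min}(s)-T^{\rm start}_{\max}(s)\}$. Subpath domination: for feasible partial subpaths with the same start and end nodes, $s_1\succeq s_2$ iff $\overline c(s_1)-\overline c(s_2)\le\sum_{q\in\mathcal Q}\lambda_q\mathbb 1(\alpha_q(s_1)>\alpha_q(s_2))$, $D(s_1)\le D(s_2)$, $B(s_1)\le B(s_2)$, $T^{\rm end}_{\min}(s_1)\le T^{\rm end}_{\min}(s_2)$, $T^{\rm start}_{\max}(s_1)\ge T^{\rm start}_{\max}(s_2)$ and $Q(s_1)\le Q(s_2)$. **Paths.** A partial path $p$ is a node sequence $(n_0,\dots,n_m)$ along arcs with $n_0\in\mathcal V_D$ and $n_1,\dots,n_{m-1}\in\mathcal V_C\cup\mathcal V_S$. It is feasible if there are charging times $\tau_k\ge0$ ($n_k\in\mathcal V_S$; put $\tau_k=0$ otherwise) such that with $t_0=0$, $b_0=B$, $t_{k+1}=\max\{t_k+\tau_k+t_{n_k,n_{k+1}},\alpha_{n_{k+1}}\}$, and $b_{k+1}=g_C(b_k,\tau_k)-b_{n_k,n_{k+1}}$ if $n_k\in\mathcal V_S$, $b_{k+1}=b_k-b_{n_k,n_{k+1}}$ otherwise, one has $\sum_k d_{n_k}\le D$, $b_k\in[0,B]$, $t_k\in[\alpha_{n_k},\beta_{n_k}]$ for all $k$. Partial paths considered here end at non-customer nodes and are concatenations $p=(s_1,\dots,s_m)$ of subpaths (or a single depot node). A subpath $s$ extends $p$ if the end node of $p$ equals the start node of $s$ and is in $\mathcal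 V_S$ (or $p$ is the single depot node at which $s$ starts); the concatenation (shared node counted once) is $p\oplus s$. Further resources: $D(p)$ (total load); $T^{\rm end}_{\min}(p)$, the minimum of $T^{\rm end}_m$ subject to $T^{\rm start}_1=0$; $T^{\rm start}_k\le T^{\rm start}_{\max}(s_k)$; $T^{\rm end}_m\le T$; $T^{\rm start}_{k+1}=T^{\rm end}_k+\tau_k$; $T^{\rm end}_k=\max\{T^{\rm start}_k+T^{\rm travel}(s_k),T^{\rm end}_{\min}(s_k)\}$; $B^{\rm start}_1=B$; $B^{\rm end}_k=B^{\rm start}_k-B(s_k)$; $B^{\rm start}_{k+1}=g_C(B^{\rm end}_k,\tau_k)$; all variables nonnegative; and $B^{\rm end}_{\max}(p)$, the maximum of $B^{\rm end}_m$ under the same constraints plus $T^{\rm end}_m=T^{\rm end}_{\min}(p)$. (Single depot node: $D=0$, $T^{\rm end}_{\min}=0$, $B^{\rm end}_{\max}=B$.) Path domination: for feasible partial paths with the same start and end nodes, $p_1\succeq p_2$ iff $\overline c(p_1)-\overline c(p_2)\le\sum_{q\in\mathcal Q}\lambda_q\mathbb 1(\alpha_q(p_1)>\alpha_q(p_2))$, $D(p_1)\le D(p_2)$ and $T^{\rm end}_{\min}(p_1)+g_T(B^{\rm end}_{\max}(p_1),\max\{B^{\rm end}_{\max}(p_1),B^{\rm end}_{\max}(p_2)\})\le T^{\rm end}_{\min}(p_2)$. *)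

(* Defs.v *)
From mathcomp Require Import all_boot all_order all_algebra.
From mathcomp Require Import boolp classical_sets set_interval reals.
From mathcomp Require Import interval_inference topology normedtype convex.

Set Implicit Arguments.
Unset Strict Implicit.
Unset Printing Implicit Defensive.

Import Order.TTheory GRing.Theory Num.Theory.
Import numFieldNormedType.Exports.

Local Open Scope ring_scope.

(* The least (greatest) element of a set of reals; the value is 0 if there is
   none. *)
Definition minimum (R : realType) (A : set R) : R :=
  xget 0 (A `&` lbound A)%classic.
Definition maximum (R : realType) (A : set R) : R :=
  xget 0 (A `&` ubound A)%classic.

(* The arc data are total functions, of which only the values on arcs matter.
   Likewise [charge] is meant on the nonnegative reals; [charge_full] is the
   part of the invertibility assumption saying that [battery] is attained. *)
Record instance (R : realType) := Instance {
  vertex : finType;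
  arc : rel vertex;
  customers : {set vertex};
  depots : {set vertex};
  stations : {set vertex};
  horizon : R;
  battery : R;
  capacity : R;
  travel : vertex -> vertex -> R;
  cost : vertex -> vertex -> R;
  energy : vertex -> vertex -> R;
  demand : vertex -> R;
  tw_open : vertex -> R;
  tw_close : vertex -> R;
  charge : R -> R;
  vertex_cover : customers :|: depots :|: stations = [set: vertex];
  customers_depots : [disjoint customers & depots];
  customers_stations : [disjoint customers & stations];
  depots_stations : [disjoint depots & stations];
  travel_gt0 : forall i j, arc i j -> 0 < travel i j;
  cost_gt0 : forall i j, arc i j -> 0 < cost i j;
  energy_gt0 : forall i j, arc i j -> 0 < energy i j;
  demand_ge0 : forall i, 0 <= demand i;
  time_window : forall i, 0 <= tw_open i <= tw_close i /\ tw_close i <= horizon;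
  depot_station_data : forall i, i \in depots :|: stations ->
    [/\ demand i = 0, tw_open i = 0 & tw_close i = horizon];
  charge_range : forall x : R, 0 <= x -> 0 <= charge x <= battery;
  charge0 : charge 0 = 0;
  charge_concave :
    @convex_function R R^o [set` `[0, +oo[]%classic (fun x => - charge x);
  charge_continuous : {within [set` `[0, +oo[], continuous charge}%classic;
  charge_nondecreasing : forall x y : R, 0 <= x -> x <= y -> charge x <= charge y;
  charge_increasing : forall x y : R,
    0 <= x -> x < y -> charge x < battery -> charge x < charge y;
  charge_full : exists2 x : R, 0 <= x & charge x = battery
}.

(* Dual prices and subset-row cuts; [kappa] and [mu] matter only on depots,
   [nu] only on customers, and [weight q] only on [support q]. *)
Record pricing (R : realType) (I : instance R) := Pricing {
  kappa : vertex I -> R;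
  mu : vertex I -> R;
  nu : vertex I -> R;
  cut : finType;
  support : cut -> {set vertex I};
  weight : cut -> vertex I -> R;
  lambda : cut -> R;
  support_customers : forall q, support q \subset customers I;
  weight_ge0 : forall q i, i \in support q -> 0 <= weight q i;
  lambda_le0 : forall q, lambda q <= 0
}.

Section Definitions.
Context {R : realType} (I : instance R).
Local Notation V := (vertex I).

Definition charge_inv (b : R) : R :=
  minimum [set x | 0 <= x /\ charge I x = b]%classic.
Definition gT (b1 b2 : R) : R := charge_inv b2 - charge_inv b1.
Definition gC (b x : R) : R := charge I (charge_inv b + x).

(* A nonempty node sequence (n_0, ..., n_m) is the pair of n_0 and of the
   sequence n_1, ..., n_m. *)
Definition nodes : Type := (V * seq V)%type.
Implicit Types N s p : nodes.

Definition node_seq N : seq V := N.1 :: N.2.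
Definition start N : V := N.1.
Definition stop N : V := last N.1 N.2.
Definition arcs_nb N : nat := size N.2.
Definition node N (k : nat) : V := nth N.1 (node_seq N) k.
Definition along_arcs N : bool := path (@arc R I) N.1 N.2.
Definition inner N : seq V := behead (belast N.1 N.2).

Definition extend_arc s (a : V * V) : nodes := (s.1, rcons s.2 a.2).
Definition concat p s : nodes := (p.1, p.2 ++ s.2).

Definition arc_sum (f : V -> V -> R) N : R :=
  \sum_(l < arcs_nb N) f (node N l) (node N l.+1).
Definition load N : R := \sum_(i <- node_seq N) demand i.
Definition energy_use N : R := arc_sum (@energy R I) N.
Definition travel_time N : R := arc_sum (@travel R I) N.

Section Pricing.
Variable P : pricing I.

Definition arc_rcost (i j : V) : R :=
  cost i j - (i \in depots I)%:R * kappa P i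
             - (j \in depots I)%:R * mu P j
             - (j \in customers I)%:R * nu P j.
Definition omega (q : cut P) N : R :=
  \sum_(i <- node_seq N | i \in support q) weight q i.
Definition alpha (q : cut P) N : R := omega q N - (Num.floor (omega q N))%:~R.
Definition rcost N : R :=
  arc_sum arc_rcost N
  - \sum_(q : cut P) lambda q * (Num.floor (omega q N))%:~R.
Definition rcost_dominates N1 N2 : Prop :=
  rcost N1 - rcost N2 <=
  \sum_(q : cut P) lambda q * (alpha q N2 < alpha q N1)%R%:R.
End Pricing.

Definition partial_subpath s : bool :=
  [&& along_arcs s, start s \in depots I :|: stations I
    & all (mem (customers I)) (inner s)].
Definition subpath s : bool :=
  partial_subpath s && (stop s \in depots I :|: stations I).

Fixpoint sub_time s (t0 : R) (k : nat) : R :=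
  if k is k'.+1 then
    Num.max (sub_time s t0 k' + travel (node s k') (node s k))
            (tw_open (node s k))
  else t0.
Fixpoint sub_battery s (b0 : R) (k : nat) : R :=
  if k is k'.+1 then sub_battery s b0 k' - energy (node s k') (node s k)
  else b0.

Definition feasible_resources s (t b : nat -> R) : Prop :=
  load s <= capacity I /\
  forall k, (k <= arcs_nb s)%N ->
    0 <= b k <= battery I /\ tw_open (node s k) <= t k <= tw_close (node s k).

Definition feasible_partial_subpath s : Prop :=
  partial_subpath s /\
  exists t0 b0, feasible_resources s (sub_time s t0) (sub_battery s b0).
Definition feasible_subpath s : Prop :=
  subpath s /\ feasible_partial_subpath s.

Definition Tend_min_sub s : R := sub_time s (tw_open (start s)) (arcs_nb s).

(* T^L_0, where T^L_m = tw_close n_m and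
   T^L_l = min (T^L_(l+1) - travel n_l n_(l+1), tw_close n_l), for the node
   sequence (x, p). *)
Fixpoint latest_start (x : V) (p : seq V) : R :=
  if p is y :: p' then
    Num.min (latest_start y p' - travel x y) (tw_close x)
  else tw_close x.
Definition Tstart_max s : R := latest_start s.1 s.2.
Definition Qspan s : R :=
  Num.max (travel_time s) (Tend_min_sub s - Tstart_max s).

Definition dominates_sub (P : pricing I) s1 s2 : Prop :=
  [/\ start s1 = start s2 /\ stop s1 = stop s2,
      rcost_dominates P s1 s2,
      load s1 <= load s2 /\ energy_use s1 <= energy_use s2,
      Tend_min_sub s1 <= Tend_min_sub s2 /\ Tstart_max s1 >= Tstart_max s2
    & Qspan s1 <= Qspan s2].

(* Partial paths ending at a depot or a station. *)
Definition partial_path p : bool :=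
  [&& along_arcs p, start p \in depots I,
      all (mem (customers I :|: stations I)) (inner p)
    & stop p \notin customers I].

Fixpoint path_time p (tau : nat -> R) (k : nat) : R :=
  if k is k'.+1 then
    Num.max (path_time p tau k' + tau k' + travel (node p k') (node p k))
            (tw_open (node p k))
  else 0.
Fixpoint path_battery p (tau : nat -> R) (k : nat) : R :=
  if k is k'.+1 then
    (if node p k' \in stations I then gC (path_battery p tau k') (tau k')
     else path_battery p tau k') - energy (node p k') (node p k)
  else battery I.

Definition feasible_path p : Prop :=
  partial_path p /\
  exists tau : nat -> R,
    [/\ forall k, 0 <= tau k,
        forall k, node p k \notin stations I -> tau k = 0
      & feasible_resources p (path_time p tau) (path_battery p tau)].

Definition extends_arc s (a : V * V) : Prop := arc a.1 a.2 /\ a.1 = stop s.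
Definition extends_path p s : Prop :=
  stop p = start s /\
  (stop p \in stations I \/ p.2 = [::] /\ start p \in depots I).

(* p = (s_1, ..., s_m). Subpaths without arcs are excluded, so that the
   decomposition is unique. *)
Definition decomposition (ss : seq nodes) p : Prop :=
  [/\ path (fun s s' => stop s == start s') (start p, [::]) ss,
      {in ss, forall s, subpath s /\ (0 < arcs_nb s)%N}
    & p = foldl concat (start p, [::]) ss].

(* The constraints linking charging times, and times and battery levels at the
   starts and ends of the subpaths; the k-th subpath has index k - 1. *)
Definition schedule p (ss : seq nodes) (tau Ts Te Bs Be : nat -> R) : Prop :=
  let m := size ss in
  let s := nth p ss in
  [/\ Ts 0%N = 0 /\ Bs 0%N = battery I,
      forall k, (k < m)%N ->
        [/\ Ts k <= Tstart_max (s k),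
            Te k = Num.max (Ts k + travel_time (s k)) (Tend_min_sub (s k))
          & Be k = Bs k - energy_use (s k)],
      forall k, (k.+1 < m)%N ->
        [/\ 0 <= tau k, Ts k.+1 = Te k + tau k & Bs k.+1 = gC (Be k) (tau k)],
      Te m.-1 <= horizon I
    & forall k, (k < m)%N ->
        [/\ 0 <= Ts k, 0 <= Te k, 0 <= Bs k & 0 <= Be k]].

(* The end time and end battery level [x] of a schedule of [p]. *)
Definition schedulable p (x : R * R) : Prop :=
  exists ss tau Ts Te Bs Be,
    [/\ decomposition ss p, schedule p ss tau Ts Te Bs Be
      & x = (Te (size ss).-1, Be (size ss).-1)].

Definition Tend_min_path p : R :=
  if p.2 is [::] then 0
  else minimum [set t | exists b, schedulable p (t, b)]%classic.
Definition Bend_max_path p : R :=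
  if p.2 is [::] then battery I
  else maximum [set b | schedulable p (Tend_min_path p, b)]%classic.

Definition dominates_path (P : pricing I) p1 p2 : Prop :=
  [/\ start p1 = start p2 /\ stop p1 = stop p2,
      rcost_dominates P p1 p2,
      load p1 <= load p2
    & Tend_min_path p1
      + gT (Bend_max_path p1) (Num.max (Bend_max_path p1) (Bend_max_path p2))
      <= Tend_min_path p2].
End Definitions.

(* Main.v *)
Require Import Defs.
From mathcomp Require Import all_boot all_order all_algebra reals.
From mathcomp Require Import boolp classical_sets set_interval.
From mathcomp Require Import interval_inference topology normedtype convex.
From mathcomp Require Import lra.

Set Implicit Arguments.
Unset Strict Implicit.
Unset Printing Implicit Defensive.

Import Order.TTheory GRing.Theory Num.Theory.
Import numFieldNormedType.Exports.

Local Open Scope ring_scope.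

(** The state in which a vehicle ends a partial path is a pair (t, b) of a time
    and a battery level.  Driving a subpath s from a state (departure at time u
    with battery b) ends at time max (u + T_travel(s)) (T_end_min(s)), costs
    B(s) of battery, and is possible exactly when u <= T_start_max(s),
    B(s) <= b and the time windows of s can be met at all ([timelyE],
    [sub_time_end], [sub_battery_range]).  Both the node-by-node feasibility of
    a path and the schedules of its subpaths are built by this one step
    ([reaches_concat], [scheduled_concat], [scheduled_concat_inv]), so that they
    produce the same states ([reaches_scheduled]).

    A state (t1, b1) dominates (t2, b2) when t1 <= t2 and
    g^-1(b2) - g^-1(b1) <= t2 - t1: charging during the time gained yields at
    least the battery of the second state.  This relation is transitive.  The
    key fact is that the states of a path, if there are any, have a dominating
    element ([best_state_exists]), which is (T_end_min(p), B_end_max(p))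
    ([best_state_ends]); hence path domination compares these best states
    ([best_state_dominates]).  Existence is proved by induction along the
    subpaths: from the best state one charges as little as the next subpath
    requires, and then on as long as this does not delay the arrival
    ([latest_free_delay]).  Charging longer delays the arrival by the additional
    time, and by concavity of g the battery gained before the subpath is at most
    the one that could be gained afterwards, from a lower level
    ([charge_slope], [leg_best]).

    Parts (ii) and (iii) then only require simulating a state of the dominated
    path by a dominating state of the other one, with the same time of departure
    ([leg_better], [leg_dominates_sub]); the best states do the rest
    ([dominates_path_states]).  In (iii) and in (i) the condition on Q bounds
    T_travel(s1) either by T_travel(s2) or by T_end_min(s2) - T_start_max(s2);
    in the second case a departure no later than T_start_max(s2) lets s1 drive
    all its arcs by the time T_end_min(s2), before which s2 cannot end
    ([dominates_sub_concat]).

    For the reduced costs, adding the same weight to two cut values changes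
    their floors by amounts that differ by at most one, and a difference is
    compensated by the change in the comparison of the fractional parts
    ([floor_frac_shift]).  A common continuation adds the same weights to both
    sequences; so does a common path in front of two subpaths, because the node
    that it shares with them is no customer and lies in no cut. *)

(** * Fractional parts *)

(** The fractional part of a real number. *)
Definition frac (R : realType) (z : R) : R := z - (Num.floor z)%:~R.

(** When w is added to x and to y, the floor of x gains at most as much as the
    floor of y, plus one if the fractional part of x was the larger one before,
    minus one if it is the larger one afterwards. *)
Lemma floor_frac_shift (R : realType) (x y w : R) :
  (frac (y + w) < frac (x + w))%R%:R
  + ((Num.floor (x + w))%:~R - (Num.floor x)%:~R)
  <= (frac y < frac x)%R%:R + ((Num.floor (y + w))%:~R - (Num.floor y)%:~R)
  :> R.
Proof.
have fl z : (Num.floor z)%:~R <= z :> R by exact: floor_le.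
have fl1 z : z < (Num.floor z)%:~R + 1 :> R.
  by have := floorD1_gt z; rewrite intrD.
have Hx := fl x; have Hx1 := fl1 x; have Hy := fl y; have Hy1 := fl1 y.
have Hxw := fl (x + w); have Hxw1 := fl1 (x + w).
have Hyw := fl (y + w); have Hyw1 := fl1 (y + w).
have int_le (m n : int) : m%:~R < n%:~R + 1 :> R -> m%:~R <= n%:~R :> R.
  by rewrite -[1]/(1%:~R) -intrD ltr_int ler_int ltzD1.
pose m := (Num.floor (x + w) - Num.floor x)%R.
pose n := (Num.floor (y + w) - Num.floor y)%R.
have Em : m%:~R = (Num.floor (x + w))%:~R - (Num.floor x)%:~R :> R.
  by rewrite intrB.
have En : n%:~R = (Num.floor (y + w))%:~R - (Num.floor y)%:~R :> R.
  by rewrite intrB.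
rewrite -Em -En /frac.
case: ltP => h1; case: ltP => h2; rewrite /=.
- by rewrite lerD2l; apply: int_le; lra.
- suff : (m + 1)%:~R <= n%:~R :> R by rewrite intrD /=; lra.
  by apply: int_le; rewrite intrD /=; lra.
- suff : m%:~R <= (n + 1)%:~R :> R by rewrite intrD /=; lra.
  by apply: int_le; rewrite intrD /=; lra.
- by rewrite lerD2l; apply: int_le; lra.
Qed.

(** * The charging function *)

Section Charging.
Context {R : realType} (I : instance R).

Lemma battery_ge0 : 0 <= battery I.
Proof. by have /andP[/le_trans] := @charge_range R I 0 (lexx 0); apply. Qed.

Lemma charge_continuous_itv (a b : R) : 0 <= a ->
  {within `[a, b], continuous (charge I)}%classic.
Proof.
move=> a0; apply: continuous_subspaceW (@charge_continuous R I) => x /=.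
rewrite ?inE /= !in_itv /= ?andbT => /andP[ax _].
exact: le_trans a0 (ax : a <= x).
Qed.

Lemma charge_surj (a b c : R) : 0 <= a -> a <= b ->
  charge I a <= c <= charge I b -> exists2 x, a <= x <= b & charge I x = c.
Proof.
move=> a0 ab /andP[ac cb]; have lab := charge_nondecreasing I a0 ab.
have [|x] := IVT (v := c) ab (charge_continuous_itv (b := b) a0).
  by rewrite ge_min ac /= le_max cb orbT.
by rewrite in_itv /=; exists x.
Qed.

(** The minimum that defines [charge_inv] is attained: at the infimum of the
    preimages a level below b would, by continuity, leave room for a level in
    between, attained after the infimum and before all preimages. *)
Lemma charge_inv_spec (b : R) : 0 <= b <= battery I ->
  [/\ 0 <= charge_inv I b, charge I (charge_inv I b) = b &
      forall x, 0 <= x -> charge I x = b -> charge_inv I b <= x].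
Proof.
move=> /andP[b0 bB].
set A := [set x : R | 0 <= x /\ charge I x = b]%classic.
suff [x Ax] : exists x, (A `&` lbound A)%classic x.
  have [[h1 h2] h3] : (A `&` lbound A)%classic (charge_inv I b).
    by rewrite /charge_inv /minimum; apply: xgetPex; exists x.
  by split => // y y0 yb; apply: h3.
have [xf xf0 xfB] := charge_full I.
have [y /andP[y0 yxf] yb] : exists2 y, 0 <= y <= xf & charge I y = b.
  by apply: charge_surj => //; rewrite charge0 b0 xfB.
have Ay : A y by [].
have A0 : lbound A 0 by move=> z [].
have hl : has_lbound A by exists 0.
have hi : has_inf A by split => //; exists y.
exists (inf A); split; last by move=> z; exact: ge_inf.
have i0 : 0 <= inf A by apply: lb_le_inf; first by exists y.
split => //; apply/eqP; rewrite eq_le -{1}yb charge_nondecreasing //=;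
  last first.
  exact: ge_inf.
rewrite leNgt; apply/negP => lt_ib.
pose c := (charge I (inf A) + b) / 2.
have [z /andP[iz zy] zc] : exists2 z, inf A <= z <= y & charge I z = c.
  apply: charge_surj => //; first exact: ge_inf.
  by rewrite yb; apply/andP; split; rewrite /c; lra.
suff : z <= inf A.
  move=> zi; have ez : z = inf A by apply: le_anti; rewrite zi iz.
  by move: zc; rewrite ez /c; lra.
apply: lb_le_inf; first by exists y.
move=> u [u0 ub]; rewrite leNgt; apply/negP => uz.
by have := charge_nondecreasing I u0 (ltW uz); rewrite ub zc /c; lra.
Qed.

Lemma charge_inv_ge0 (b : R) : 0 <= b <= battery I -> 0 <= charge_inv I b.
Proof. by case/charge_inv_spec. Qed.

Lemma charge_invK (b : R) : 0 <= b <= battery I ->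
  charge I (charge_inv I b) = b.
Proof. by case/charge_inv_spec. Qed.

(** [charge_inv] and [charge] form a Galois connection. *)
Lemma charge_inv_le (b x : R) : 0 <= b <= battery I -> 0 <= x ->
  (charge_inv I b <= x) = (b <= charge I x).
Proof.
move=> hb x0; have [i0 ib imin] := charge_inv_spec hb.
apply/idP/idP => [ix|bx]; first by rewrite -ib charge_nondecreasing.
rewrite leNgt; apply/negP => xi.
have := charge_nondecreasing I x0 (ltW xi); rewrite ib => xb.
suff : charge_inv I b <= x by lra.
by apply: imin => //; apply: le_anti; rewrite xb bx.
Qed.

Lemma charge_inv_mono (b c : R) : 0 <= b <= battery I -> 0 <= c <= battery I ->
  b <= c -> charge_inv I b <= charge_inv I c.
Proof.
by move=> hb hc bc; rewrite charge_inv_le ?charge_inv_ge0 // charge_invK.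
Qed.

(** Concavity: the same charging time yields more from a lower level.  Both
    y and x + d lie between x and y + d, with exchanged weights. *)
Lemma charge_slope (x y d : R) : 0 <= x -> x <= y -> 0 <= d ->
  charge I (y + d) - charge I y <= charge I (x + d) - charge I x.
Proof.
move=> x0 xy d0.
have [e|ne] := eqVneq (y + d) x.
  have -> : y = x by lra. by [].
have lt : 0 < y + d - x by lra.
pose t := (y - x) / (y + d - x).
have t01 : 0 <= t <= 1.
  by rewrite divr_ge0 ?ler_pdivrMr /=; lra.
pose ti := Itv01 (proj1 (andP t01)) (proj2 (andP t01)).
have memI z : 0 <= z -> z \in [set` `[(0 : R), +oo[]%classic.
  by move=> z0; apply/mem_set; rewrite /= inE /= in_itv /= z0.
have conc a b : 0 <= a -> 0 <= b ->
  - charge I (t * a + (1 - t) * b) <= t * - charge I a + (1 - t) * - charge I b.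
  by move=> a0 b0; exact: (charge_concave I ti (memI _ a0) (memI _ b0)).
have h1 := conc (y + d) x; have h2 := conc x (y + d); move: h1 h2.
have td : t * (y + d - x) = y - x by rewrite /t divfK //; lra.
have -> : t * (y + d) + (1 - t) * x = y by lra.
have -> : t * x + (1 - t) * (y + d) = x + d by lra.
by move=> h1 h2; have := h1 ltac:(lra) x0; have := h2 x0 ltac:(lra); lra.
Qed.

Lemma gC0 (b : R) : 0 <= b <= battery I -> gC I b 0 = b.
Proof. by move=> hb; rewrite /gC addr0 charge_invK. Qed.

Lemma gC_range (b x : R) : 0 <= b <= battery I -> 0 <= x ->
  0 <= gC I b x <= battery I.
Proof. by move=> hb x0; rewrite charge_range // addr_ge0 // charge_inv_ge0. Qed.

Lemma charge_inv_gC (b x : R) : 0 <= b <= battery I -> 0 <= x ->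
  charge_inv I (gC I b x) <= charge_inv I b + x.
Proof.
move=> hb x0; rewrite charge_inv_le ?gC_range //.
by rewrite addr_ge0 // charge_inv_ge0.
Qed.
End Charging.

(** * Concatenation of node sequences and reduced costs *)

Section NodeSequences.
Context {R : realType} (I : instance R).
Local Notation V := (vertex I).
Implicit Types (p s u N : nodes I) (x y : V) (l : seq V).

Lemma stop_concat p s : stop p = start s -> stop (concat p s) = stop s.
Proof. by rewrite /stop /start /= last_cat => ->. Qed.

Lemma along_concat p s : stop p = start s ->
  along_arcs (concat p s) = along_arcs p && along_arcs s.
Proof. by rewrite /along_arcs /stop /start /= cat_path => ->. Qed.

Lemma concat_nil p v : concat p (v, [::]) = p.
Proof. by case: p => x l; rewrite /concat /= cats0. Qed.

Lemma arc_sum_nil (f : V -> V -> R) x : arc_sum f (x, [::]) = 0.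
Proof. by rewrite /arc_sum /= big_ord0. Qed.

Lemma node0 N : node N 0 = start N. Proof. by []. Qed.

Lemma node_cons x y l k : (k <= size l)%N ->
  node ((x, y :: l) : nodes I) k.+1 = node ((y, l) : nodes I) k.
Proof. by move=> kl; rewrite /node /=; apply: set_nth_default. Qed.

Lemma arc_sum_cons (f : V -> V -> R) x y l :
  arc_sum f (x, y :: l) = f x y + arc_sum f (y, l).
Proof.
rewrite /arc_sum /arcs_nb /= big_ord_recl; congr (_ + _).
by apply: eq_bigr => i _; rewrite lift0 !node_cons // ltnW.
Qed.

Lemma arc_sum_concat (f : V -> V -> R) p s : stop p = start s ->
  arc_sum f (concat p s) = arc_sum f p + arc_sum f s.
Proof.
case: p => x l; elim: l x => [|y l IH] x.
  by rewrite /stop /start /= => ->; case: s => ? ?; rewrite arc_sum_nil add0r.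
rewrite /stop /start /= => e; rewrite [LHS]arc_sum_cons arc_sum_cons -addrA.
by rewrite -IH.
Qed.

Lemma big_nodes_concat (Q : pred V) (f : V -> R) p s :
  \sum_(i <- node_seq (concat p s) | Q i) f i
  = \sum_(i <- node_seq p | Q i) f i + \sum_(i <- s.2 | Q i) f i.
Proof. by rewrite /node_seq /= -cat_cons big_cat. Qed.

Lemma node_concatl p s k : (k <= size p.2)%N -> node (concat p s) k = node p k.
Proof.
by move=> kp; rewrite /node /node_seq /= -cat_cons nth_cat /= ltnS kp.
Qed.

Lemma node_stop p : node p (size p.2) = stop p.
Proof.
by rewrite /node /node_seq /stop; case: p => x l /=; rewrite nth_last.
Qed.

Lemma node_concatr p s k : stop p = start s -> (k <= size s.2)%N ->
  node (concat p s) (size p.2 + k) = node s k.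
Proof.
move=> e; case: k => [|k] ks.
  by rewrite addn0 node_concatl // node_stop e.
rewrite /node /node_seq /= addnS /= nth_cat ltnNge leq_addr /= addKn.
exact: set_nth_default.
Qed.

Lemma inner_concat p s : (0 < size p.2)%N -> (0 < size s.2)%N ->
  stop p = start s ->
  inner (concat p s) = inner p ++ stop p :: inner s.
Proof.
case: p => x [|y l] //= _; case: s => v [|z l'] //= _.
rewrite /stop /start /inner /= => _.
by rewrite belast_cat.
Qed.

(** Depots and stations ([noncustomerE]), where subpaths start and end. *)
Definition noncustomer x := x \notin customers I.

Lemma noncustomerE x : noncustomer x = (x \in depots I :|: stations I).
Proof.
have h : x \in customers I :|: depots I :|: stations I.
  by rewrite vertex_cover inE.
rewrite /noncustomer; apply/idP/idP.
  by move: h; rewrite !inE -orbA => /orP[->|].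
rewrite inE => /orP[xd|xs]; apply/negP => xc.
  by have /disjointFr /(_ xc) := customers_depots I; rewrite xd.
by have /disjointFr /(_ xc) := customers_stations I; rewrite xs.
Qed.

Lemma depot_noncustomer x : x \in depots I -> noncustomer x.
Proof. by rewrite noncustomerE inE => ->. Qed.

Lemma depot_not_station x : x \in depots I -> x \notin stations I.
Proof.
by move=> xd; apply/negP => xs; have /disjointFr /(_ xd) := depots_stations I;
  rewrite xs.
Qed.

Lemma energy_use_ge0 s : along_arcs s -> 0 <= energy_use s.
Proof.
case: s => x l; elim: l x => [|y l IH] x;
  first by rewrite /energy_use arc_sum_nil.
rewrite /along_arcs /= => /andP[a h]; rewrite /energy_use arc_sum_cons.
by rewrite addr_ge0 ?(ltW (energy_gt0 a)) ?IH.
Qed.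

Lemma energy_use_gt0 s : along_arcs s -> (0 < size s.2)%N -> 0 < energy_use s.
Proof.
case: s => x [|y l] //; rewrite /along_arcs /= => /andP[a h] _.
rewrite /energy_use arc_sum_cons ltr_wpDr ?energy_gt0 //.
exact: (@energy_use_ge0 (y, l)).
Qed.

Lemma travel_time_ge0 s : along_arcs s -> 0 <= travel_time s.
Proof.
case: s => x l; elim: l x => [|y l IH] x;
  first by rewrite /travel_time arc_sum_nil.
rewrite /along_arcs /= => /andP[a h]; rewrite /travel_time arc_sum_cons.
by rewrite addr_ge0 ?(ltW (travel_gt0 a)) ?IH.
Qed.

Section Pricing.
Variable P : pricing I.

(** Cost domination is preserved if both arc sums grow by c, and both values of
    each cut q by w q. *)
Lemma rcost_dominates_shift N1 N2 N1' N2' (c : R) (w : cut P -> R) :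
  arc_sum (arc_rcost P) N1' = arc_sum (arc_rcost P) N1 + c ->
  arc_sum (arc_rcost P) N2' = arc_sum (arc_rcost P) N2 + c ->
  (forall q, omega q N1' = omega q N1 + w q) ->
  (forall q, omega q N2' = omega q N2 + w q) ->
  rcost_dominates P N1 N2 -> rcost_dominates P N1' N2'.
Proof.
move=> c1 c2 w1 w2; rewrite /rcost_dominates /rcost c1 c2 => h.
set X := \sum_(q : cut P) lambda q * (Num.floor (omega q N1))%:~R in h.
set Y := \sum_(q : cut P) lambda q * (Num.floor (omega q N2))%:~R in h.
set X' := \sum_(q : cut P) lambda q * (Num.floor (omega q N1'))%:~R.
set Y' := \sum_(q : cut P) lambda q * (Num.floor (omega q N2'))%:~R.
suff : \sum_(q : cut P) lambda q * (alpha q N2 < alpha q N1)%R%:R + (Y' - Y)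
       <= \sum_(q : cut P) lambda q * (alpha q N2' < alpha q N1')%R%:R
          + (X' - X).
  by move=> h'; move: h h'; lra.
rewrite /X' /X /Y' /Y -!sumrB -!big_split /=; apply: ler_sum => q _.
rewrite -!mulrBr -!mulrDr; apply: ler_wnM2l; first exact: lambda_le0.
by rewrite /alpha w1 w2; exact: floor_frac_shift.
Qed.

Lemma rcost_dominates_concatr N1 N2 u : stop N1 = start u ->
  stop N2 = start u ->
  rcost_dominates P N1 N2 -> rcost_dominates P (concat N1 u) (concat N2 u).
Proof.
move=> e1 e2 h; apply: (@rcost_dominates_shift N1 N2 _ _
  (arc_sum (arc_rcost P) u)
  (fun q => \sum_(i <- u.2 | i \in Defs.support q) weight q i) _ _ _ _ h).
- exact: arc_sum_concat.
- exact: arc_sum_concat.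
- by move=> q; rewrite /omega big_nodes_concat.
- by move=> q; rewrite /omega big_nodes_concat.
Qed.

Lemma rcost_dominates_concatl p N1 N2 : stop p = start N1 ->
  stop p = start N2 ->
  noncustomer (stop p) ->
  rcost_dominates P N1 N2 -> rcost_dominates P (concat p N1) (concat p N2).
Proof.
have om N q : noncustomer (start N) ->
  omega q (concat p N) = omega q N + omega q p.
  move=> nc; rewrite /omega big_nodes_concat addrC; congr (_ + _).
  rewrite /node_seq big_cons.
  case: ifP => // hq; have := fintype.subsetP (support_customers q) _ hq.
  by rewrite (negPf nc).
move=> e1 e2 nc h; apply: (@rcost_dominates_shift N1 N2 _ _
  (arc_sum (arc_rcost P) p)
  (fun q => omega q p) _ _ _ _ h).
- by rewrite arc_sum_concat // addrC.
- by rewrite arc_sum_concat // addrC.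
- by move=> q; rewrite om // -e1.
- by move=> q; rewrite om // -e2.
Qed.
End Pricing.

Lemma load_concatr N u : load (concat N u) = load N + \sum_(i <- u.2) demand i.
Proof. by rewrite /load big_nodes_concat. Qed.

Lemma load_concat p s : noncustomer (start s) ->
  load (concat p s) = load p + load s.
Proof.
rewrite noncustomerE => /depot_station_data[d0 _ _].
by rewrite load_concatr; congr (_ + _);
  rewrite /load /node_seq big_cons d0 add0r.
Qed.
End NodeSequences.

(** * Time windows and batteries along a subpath *)

Section Timing.
Context {R : realType} (I : instance R).
Local Notation V := (vertex I).
Implicit Types (p s u N : nodes I) (x y : V) (l : seq V) (t b : R).

Lemma sub_time_cons x y l t k : (k <= size l)%N ->
  sub_time ((x, y :: l) : nodes I) t k.+1
  = sub_time ((y, l) : nodes I) (Num.max (t + travel x y) (tw_open y)) k.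
Proof.
elim: k => [//|k IH] kl.
have -> : sub_time ((x, y :: l) : nodes I) t k.+2 =
  Num.max (sub_time ((x, y :: l) : nodes I) t k.+1
           + travel (node ((x, y :: l) : nodes I) k.+1)
                    (node ((x, y :: l) : nodes I) k.+2))
          (tw_open (node ((x, y :: l) : nodes I) k.+2)) by [].
by rewrite IH ?(ltnW kl) // !node_cons // ltnW.
Qed.

(** After the opening of the start, the arrival times are max-plus affine in the
    time of departure. *)
Lemma sub_time_max s t k : tw_open (start s) <= t ->
  sub_time s t k = Num.max (t + \sum_(i < k) travel (node s i) (node s i.+1))
                           (sub_time s (tw_open (start s)) k).
Proof.
move=> ht; elim: k => [|k IH]; first by rewrite big_ord0 addr0 max_l.
by rewrite /= IH big_ord_recr /= maxA addr_maxl !addrA.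
Qed.

Lemma sub_time_end s t : tw_open (start s) <= t ->
  sub_time s t (arcs_nb s) = Num.max (t + travel_time s) (Tend_min_sub s).
Proof. exact: sub_time_max. Qed.

Lemma sub_time_ge_open s t k : tw_open (start s) <= t ->
  tw_open (node s k) <= sub_time s t k.
Proof. by case: k => [//|k] _ /=; rewrite le_max lexx orbT. Qed.

(** Departing at time t at the start of s, no time window is missed.  The
    opening times are respected by waiting, except at the start itself. *)
Definition timely s t : Prop :=
  forall k, (k <= arcs_nb s)%N -> sub_time s t k <= tw_close (node s k).

Lemma timely_nil x t : timely ((x, [::]) : nodes I) t <-> t <= tw_close x.
Proof. by split=> [/(_ 0%N)|h [|k]] //; apply. Qed.

Lemma timely_cons x y l t : timely ((x, y :: l) : nodes I) t <->
  t <= tw_close x /\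
  timely ((y, l) : nodes I) (Num.max (t + travel x y) (tw_open y)).
Proof.
split=> [h|[h1 h2] [//|k] kl]; last by rewrite sub_time_cons // node_cons //;
  exact: h2.
split; first exact: (h 0%N).
by move=> k kl; rewrite -sub_time_cons //
  -[node _ _]/(node ((y, l) : nodes I) k) -(@node_cons R I x) //; exact: h.
Qed.

Lemma open_le_close x : tw_open x <= tw_close x.
Proof. by have [/andP[_ ->]] := time_window x. Qed.

(** From the opening of the start on, whether the windows can be met with
    departure at time t is decided by [Tstart_max], provided that they can be
    met when departing as early as possible. *)
Lemma timelyE s t : tw_open (start s) <= t ->
  timely s t <-> t <= Tstart_max s /\ timely s (tw_open (start s)).
Proof.
case: s => x l; rewrite /start /Tstart_max /=.
elim: l x t => [|y l IH] x t ht;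
  first by rewrite !timely_nil; have := open_le_close x; tauto.
rewrite !timely_cons /= IH ?le_max ?lexx ?orbT //.
rewrite [timely _ (Num.max (tw_open x + _) _)]IH ?le_max ?lexx ?orbT //.
rewrite le_min !ge_max lerBrDr.
have le1 : t + travel x y <= latest_start y l ->
  tw_open x + travel x y <= latest_start y l.
  by move=> h; rewrite (le_trans _ h) // lerD2r.
have := open_le_close x.
split; first by case=> -> [/andP[h1 h2] h3]; rewrite h1 h2 le1.
by case=> /andP[h1 h2] [h3 [/andP[h4 h5] h6]]; rewrite h1 h2 h5.
Qed.

Lemma latest_start_le x l : latest_start x l <= tw_close x.
Proof. by case: l => //= y l; rewrite ge_min lexx orbT. Qed.

Lemma Tstart_max_concat s u : stop s = start u ->
  Tstart_max (concat s u)
    = Num.min (Tstart_max s) (Tstart_max u - travel_time s).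
Proof.
case: s => x l; rewrite /Tstart_max /stop /=.
elim: l x => [|y l IH] x /= e.
  by rewrite /travel_time arc_sum_nil subr0 min_r e ?latest_start_le.
rewrite IH // /travel_time arc_sum_cons addr_minl -!minA; congr (Num.min _ _).
by rewrite minC opprD addrA [in RHS]addrAC.
Qed.

Lemma sub_time_concatl s u t k : (k <= size s.2)%N ->
  sub_time (concat s u) t k = sub_time s t k.
Proof.
elim: k => [//|k IH] ks; rewrite /= IH ?(ltnW ks) //.
by rewrite !node_concatl // ltnW.
Qed.

Lemma sub_time_concatr s u t k : stop s = start u -> (k <= size u.2)%N ->
  sub_time (concat s u) t (size s.2 + k)
    = sub_time u (sub_time s t (size s.2)) k.
Proof.
move=> e; elim: k => [|k IH] ku; first by rewrite addn0 sub_time_concatl.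
rewrite addnS /= IH ?(ltnW ku) // -addnS !node_concatr //; exact: ltnW.
Qed.

Lemma arcs_nb_concat s u : arcs_nb (concat s u) = (arcs_nb s + arcs_nb u)%N.
Proof. by rewrite /arcs_nb size_cat. Qed.

Lemma Tend_min_concat s u : stop s = start u ->
  Tend_min_sub (concat s u)
    = Num.max (Tend_min_sub s + travel_time u) (Tend_min_sub u).
Proof.
move=> e; rewrite {1}/Tend_min_sub arcs_nb_concat sub_time_concatr //
  -sub_time_end //.
by rewrite -e -node_stop; exact: sub_time_ge_open.
Qed.

Lemma timely_concat s u t : stop s = start u ->
  timely (concat s u) t <-> timely s t /\ timely u (sub_time s t (arcs_nb s)).
Proof.
move=> e; split.
  move=> h; split=> k kl.
    by rewrite -(sub_time_concatl u) // -(node_concatl u) //; apply: h;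
      rewrite arcs_nb_concat; exact: leq_trans kl (leq_addr _ _).
  by rewrite -sub_time_concatr // -(node_concatr e) //; apply: h;
    rewrite arcs_nb_concat leq_add2l.
move=> [h1 h2] k; rewrite arcs_nb_concat => kl.
case: (leqP k (size s.2)) => ks;
  first by rewrite sub_time_concatl // node_concatl //; exact: h1.
rewrite -(subnKC (ltnW ks)).
have kl' : (k - size s.2 <= size u.2)%N by rewrite leq_subLR.
by rewrite sub_time_concatr // node_concatr //; exact: h2.
Qed.

Lemma arc_node s k : along_arcs s -> (k < size s.2)%N ->
  Defs.arc (node s k) (node s k.+1).
Proof. by move=> /(pathP s.1) h ks; exact: h. Qed.

Lemma sub_batteryE s b : sub_battery s b (arcs_nb s) = b - energy_use s.
Proof.
rewrite /energy_use /arc_sum; elim: (arcs_nb s) => [|k IH].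
  by rewrite big_ord0 subr0.
by rewrite big_ord_recr /= IH opprD addrA.
Qed.

Lemma sub_battery_anti s b j k : along_arcs s -> (j <= k)%N ->
  (k <= arcs_nb s)%N ->
  sub_battery s b k <= sub_battery s b j.
Proof.
move=> ha; elim: k => [|k IH]; first by rewrite leqn0 => /eqP->.
rewrite leq_eqVlt => /orP[/eqP-> //|jk] ks;
  apply: le_trans (IH _ (ltnW ks)) => //=.
by rewrite gerBl; apply: ltW; apply: energy_gt0; exact: arc_node.
Qed.

Lemma sub_battery_range s b : along_arcs s -> 0 <= b <= battery I ->
  (forall k, (k <= arcs_nb s)%N -> 0 <= sub_battery s b k <= battery I) <->
  energy_use s <= b.
Proof.
move=> ha /andP[b0 bB]; split=> [/(_ _ (leqnn _))|h k kl].
  by rewrite sub_batteryE subr_ge0 => /andP[].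
have h0 := @sub_battery_anti s b 0 k ha (leq0n k) kl.
have := sub_battery_anti b ha kl (leqnn _); rewrite sub_batteryE => h1.
apply/andP; split; last exact: le_trans h0 bB.
by apply: le_trans h1; rewrite subr_ge0.
Qed.

Lemma feasible_partial_subpathE s : feasible_partial_subpath s <->
  [/\ partial_subpath s, load s <= capacity I, energy_use s <= battery I
    & timely s (tw_open (start s))].
Proof.
split=> [[ps [t [b [hl h]]]]|[ps hl he ht]].
  have ha : along_arcs s by case/and3P: ps.
  have [hb /andP[ht _]] := h 0%N (leq0n _).
  have hb' : energy_use s <= b by apply/(sub_battery_range ha hb) => k /h[].
  split=> //; first by apply: le_trans hb' _; case/andP: hb.
  by apply: (proj2 (proj1 (timelyE ht) _)) => k /h[_ /andP[]].
split=> //; exists (tw_open (start s)), (battery I); split=> // k kl.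
have ha : along_arcs s by case/and3P: ps.
split; last by rewrite ht // sub_time_ge_open.
have hB : 0 <= battery I <= battery I by rewrite lexx battery_ge0.
exact: (proj2 (sub_battery_range ha hB) he).
Qed.

(** Domination of subpaths is preserved under any common continuation u whose
    time windows can be met after the dominated one. *)
Lemma dominates_sub_concat (P : pricing I) s1 s2 u :
  along_arcs u -> stop s2 = start u ->
    timely (concat s2 u) (tw_open (start s2)) ->
  dominates_sub P s1 s2 -> dominates_sub P (concat s1 u) (concat s2 u).
Proof.
move=> ua e2 tl [[es ee] hr [hl hE] [hTE hTL] hQ].
have e1 : stop s1 = start u by rewrite ee.
have tE2 : Tend_min_sub s2 <= Tstart_max u.
  move/timely_concat: tl => /(_ e2)[_ tl].
  by apply: (proj1 (proj1 (timelyE _) tl)); rewrite -e2 -node_stop;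
    exact: sub_time_ge_open.
have hq1 : travel_time s1
    <= Num.max (travel_time s2) (Tend_min_sub s2 - Tstart_max s2).
  by apply: le_trans hQ; rewrite le_max lexx.
have hq2 : travel_time s1 <= travel_time s2 \/
    travel_time s1 <= Tend_min_sub s2 - Tstart_max s2.
  by move: hq1; rewrite le_max => /orP.
have TE : Tend_min_sub (concat s1 u) <= Tend_min_sub (concat s2 u).
  rewrite !Tend_min_concat // ge_max !le_max lexx orbT andbT.
  by rewrite lerD2r hTE.
(* in the second case of hq2, departing at Tstart_max s2 and driving all arcs
   of s1 leads to u by Tend_min_sub s2 <= Tstart_max u *)
have TL : Tstart_max (concat s2 u) <= Tstart_max (concat s1 u).
  rewrite !Tstart_max_concat // le_min !ge_min hTL /=.
  by apply/orP; case: hq2 => h; [right|left]; lra.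
split=> //.
- by rewrite /= !stop_concat.
- by apply: rcost_dominates_concatr.
- by rewrite !load_concatr lerD2r /energy_use !arc_sum_concat // lerD2r.
rewrite /Qspan ge_max; apply/andP; split; last first.
  by rewrite le_max; apply/orP; right; lra.
rewrite le_max /travel_time !arc_sum_concat //; apply/orP.
case: hq2 => h; [left; rewrite /travel_time in h; lra|right].
have h1 : Tend_min_sub s2 + travel_time u <= Tend_min_sub (concat s2 u).
  by rewrite Tend_min_concat // le_max lexx.
have h2 : Tstart_max (concat s2 u) <= Tstart_max s2.
  by rewrite Tstart_max_concat // ge_min lexx.
rewrite /travel_time in h h1; lra.
Qed.

Lemma subpath_arc_extension_dominates (P : pricing I) s1 s2 (a : V * V) :
  feasible_partial_subpath s1 -> feasible_partial_subpath s2 ->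
  dominates_sub P s1 s2 ->
  extends_arc s1 a -> extends_arc s2 a ->
  feasible_partial_subpath (extend_arc s2 a) ->
  feasible_partial_subpath (extend_arc s1 a) /\
  dominates_sub P (extend_arc s1 a) (extend_arc s2 a).
Proof.
case: a => v n f1 f2 D [/= arc1 ea1] [_ /= ea2] f2'.
pose u : nodes I := (v, [:: n]).
have E s : extend_arc s (v, n) = concat s u.
  by rewrite /extend_arc /concat /= cats1.
rewrite !E in f2' *.
move/feasible_partial_subpathE: f1 => [ps1 _ _ t1].
move/feasible_partial_subpathE: f2' => [pu2 l2 en2 t2].
have e1 : stop s1 = start u by [].
have e2 : stop s2 = start u by [].
have ua : along_arcs u by rewrite /along_arcs /= arc1.
have D' := dominates_sub_concat ua e2 t2 D.
split=> //; apply/feasible_partial_subpathE.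
have [_ _ [hl hE] _ _] := D'.
case: (D) => [[es ee] _ [_ hE0] [hTE hTL] _].
have a1 : along_arcs s1 by case/and3P: ps1.
split; [|exact: le_trans l2|exact: le_trans en2|].
- case/and3P: ps1 => _ st1 in1;
    rewrite /partial_subpath along_concat // a1 ua st1 /=.
  have [z|s1n] := posnP (size s1.2); first by case: (s1) z => x [|].
  rewrite inner_concat // all_cat in1 /= andbT.
  have s2n : (0 < size s2.2)%N.
    rewrite lt0n; apply/eqP => /eqP/nilP s2n; have := energy_use_gt0 a1 s1n.
    by move: hE0; rewrite /energy_use; case: (s2) s2n => x l /= ->;
      rewrite arc_sum_nil; lra.
  case/and3P: pu2 => _ _; rewrite inner_concat // all_cat -ee =>
    /andP[_] /= /andP[+ _].
  by [].
- move/timely_concat: t2 => /(_ e2) [_ tu];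
    apply: (proj2 (timely_concat _ e1)); split => //.
  have op s : stop s = start u -> tw_open (start u) <= Tend_min_sub s.
    by move=> <-; rewrite -node_stop; exact: sub_time_ge_open.
  have [tu1 tu2] := proj1 (timelyE (op _ e2)) tu.
  apply: (proj2 (timelyE (op _ e1))); split=> //.
  exact: le_trans hTE tu1.
Qed.
End Timing.

(** * Decomposition of paths into subpaths *)

Section Decomposition.
Context {R : realType} (I : instance R).
Local Notation V := (vertex I).
Implicit Types (p s u N : nodes I) (x y v : V) (l : seq V).

Lemma subpathP s : subpath s ->
  [/\ along_arcs s, noncustomer (start s), noncustomer (stop s)
    & all (mem (customers I)) (inner s)].
Proof. by move=> /andP[/and3P[? ? ?] ?]; split=> //; rewrite noncustomerE. Qed.

Lemma inner_node s k : (0 < k < size s.2)%N -> node s k \in inner s.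
Proof.
case: s => x [|z l]; first by rewrite andbC.
case: k => [//|k]; rewrite /= ltnS => kl; rewrite /node /inner /=.
suff -> : nth x (z :: l) k = nth x (belast z l) k by apply: mem_nth;
  rewrite size_belast.
by rewrite [z :: l]lastI nth_rcons size_belast kl.
Qed.

Lemma subpath_inner_customer s k : subpath s -> (0 < k < size s.2)%N ->
  node s k \in customers I.
Proof. by case/subpathP => _ _ _ /allP h /inner_node; exact: h. Qed.

Lemma customer_not_station x : x \in customers I -> x \notin stations I.
Proof.
move=> xc; apply/negP => xs.
have : noncustomer x by rewrite noncustomerE inE xs orbT.
by rewrite /noncustomer xc.
Qed.

(** The last subpath of a path is determined by the path: it starts at the last
    noncustomer before the end. *)
Lemma concat_inj p s p' s' : subpath s -> subpath s' ->
  (0 < size s.2)%N -> (0 < size s'.2)%N ->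
  stop p = start s -> stop p' = start s' ->
  concat p s = concat p' s' -> p = p' /\ s = s'.
Proof.
have main (q r q' r' : nodes I) : subpath r -> subpath r' ->
  (0 < size r'.2)%N ->
    stop q = start r -> stop q' = start r' -> concat q r = concat q' r' ->
    (size q'.2 <= size q.2)%N.
  move=> hr hr' r'0 e e' ee; rewrite leqNgt; apply/negP => lt.
  have sz : (size q.2 + size r.2 = size q'.2 + size r'.2)%N.
    by have := congr1 (fun N : nodes I => size N.2) ee; rewrite /= !size_cat.
  have k1 : (0 < size q'.2 - size q.2 < size r.2)%N.
    by rewrite subn_gt0 lt /= ltn_subLR ?sz ?(ltnW lt) //
      -[X in (X < _)%N]addn0 ltn_add2l.
  have := subpath_inner_customer hr k1.
  rewrite -(node_concatr e) ?subnKC ?(ltnW lt) //;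
    last by case/andP: k1 => _ /ltnW.
  rewrite ee node_concatl // node_stop e'.
  by case/subpathP: hr' => _ /negPf ->.
move=> hs hs' s0 s'0 e e' ee.
have sz : size p.2 = size p'.2.
  by apply: anti_leq; rewrite (main p' s' p s) ?(main p s p' s').
move: ee e e' sz; case: (p) => x l; case: (p') => x' l'; case: (s) => z r;
  case: (s') => z' r'.
rewrite /concat /stop /start /= => -[-> ee] <- <- sz.
by move/eqP: ee; rewrite eqseq_cat // => /andP[/eqP -> /eqP ->].
Qed.

Lemma partial_pathP p : partial_path p ->
  [/\ along_arcs p, start p \in depots I,
      all (mem (customers I :|: stations I)) (inner p)
    & noncustomer (stop p)].
Proof. by case/and4P. Qed.

Lemma partial_path_concat p s : partial_path p -> subpath s ->
  extends_path p s ->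
  (0 < size s.2)%N -> partial_path (concat p s).
Proof.
move=> /partial_pathP[ap dp ip np] /subpathP[as_ _ ns is_] [e h] s0.
rewrite /partial_path along_concat // ap as_ dp stop_concat // andbT /=.
have is' : all (mem (customers I :|: stations I)) (inner s).
  by apply: sub_all is_ => y /= yc; rewrite inE yc.
apply/andP; split; last exact: ns.
case: (posnP (size p.2)) => p0.
  move: e p0 s0 is'; case: (p) => x [|//]; case: (s) => v l;
    rewrite /stop /start /= => -> _ _.
  by [].
case: h => [st|[p20 _]]; last by rewrite p20 in p0.
by rewrite inner_concat // all_cat ip /= is' inE st orbT.
Qed.

Lemma last_noncustomer v l : noncustomer v ->
  exists l1 l2, [/\ l = l1 ++ l2,
    noncustomer (last v l1) & all (mem (customers I)) l2].
Proof.
move=> nv; elim/last_ind: l => [|l z [l1 [l2 [-> n1 c2]]]];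
  first by exists [::], [::].
have [nz|] := boolP (noncustomer z); last rewrite negbK => cz.
  by exists (rcons (l1 ++ l2) z), [::]; rewrite cats0 last_rcons.
by exists l1, (rcons l2 z); rewrite rcons_cat all_rcons /= cz.
Qed.

Lemma partial_path_split p : partial_path p -> (0 < size p.2)%N ->
  exists p0 s, [/\ p = concat p0 s, partial_path p0, extends_path p0 s,
    subpath s & (0 < size s.2)%N].
Proof.
case: p => v l; case/lastP: l => [//|l z] /partial_pathP[].
rewrite /along_arcs /start /stop /inner /= last_rcons => ap dv ip nz _.
have [l1 [l2 [el n1 c2]]] := @last_noncustomer v l (depot_noncustomer dv).
have inl : {subset l <= customers I :|: stations I}.
  move=> y yl; apply: (allP ip).
  by move: yl; case: (l) => //= y' l' ; rewrite belast_rcons.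
exists (v, l1), (last v l1, rcons l2 z); split.
- by rewrite /concat /= el rcons_cat.
- move: ap; rewrite el rcons_cat cat_path => /andP[ap1 _].
  apply/and4P; split=> //.
  apply/allP => y; rewrite /inner /= => h; apply: inl; rewrite el mem_cat.
  by apply/orP; left; move: h; case: (l1) => [//|y' l'] /= /mem_belast.
- split=> //; rewrite /stop /=; case/lastP: l1 el n1 {ap} => [|l1 y] el n1;
    first by right.
  left; have := inl y; rewrite el last_rcons mem_cat mem_rcons inE eqxx /= =>
    /(_ isT).
  by rewrite inE; move: n1; rewrite last_rcons /noncustomer => /negPf ->.
- move: ap; rewrite el rcons_cat cat_path => /andP[_ ap2].
  apply/andP; split; last by rewrite -noncustomerE /stop /= last_rcons.
  apply/and3P; split=> //; first by rewrite -noncustomerE.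
  by rewrite /inner /= belast_rcons.
- by rewrite size_rcons.
Qed.

(** Induction on partial paths, along their subpaths. *)
Lemma partial_path_ind (Q : nodes I -> Prop) :
  (forall v, v \in depots I -> Q (v, [::])) ->
  (forall p s, partial_path p -> extends_path p s -> subpath s ->
     (0 < size s.2)%N -> Q p -> Q (concat p s)) ->
  forall p, partial_path p -> Q p.
Proof.
move=> Q0 Qc p; have [n] := ubnP (size p.2).
elim: n p => // n IH p; rewrite ltnS => sp pp.
have [p0|p0] := posnP (size p.2).
  by case/partial_pathP: pp => _ + _ _; move: p0; case: (p) => x [|//] _ /=;
    exact: Q0.
have [q [s [e pq es hs s0]]] := partial_path_split pp p0.
rewrite e; apply: Qc => //; apply: IH => //; apply: leq_trans sp.
by rewrite e /= size_cat -[X in (X < _)%N]addn0 ltn_add2l.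
Qed.

Lemma stop_foldl v ss :
  path (fun s s' => stop s == start s') ((v, [::]) : nodes I) ss ->
  stop (foldl (@concat R I) (v, [::]) ss)
    = stop (last ((v, [::]) : nodes I) ss).
Proof.
elim/last_ind: ss => [//|ss s IH];
  rewrite rcons_path last_rcons => /andP[h /eqP e].
by rewrite -cats1 foldl_cat /= stop_concat // IH.
Qed.

Lemma start_foldl N ss : start (foldl (@concat R I) N ss) = start N.
Proof. by elim: ss N => [//|s ss IH] N /=; rewrite IH. Qed.

Lemma decomposition_rcons ss s q : decomposition (rcons ss s) q <->
  exists p, [/\ decomposition ss p, stop p = start s,
    subpath s /\ (0 < arcs_nb s)%N
    & q = concat p s].
Proof.
split.
  move=> [hp hs eq]; move: hp; rewrite rcons_path => /andP[hp /eqP e].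
  pose p := foldl (@concat R I) (start q, [::]) ss.
  have sp : start p = start q by rewrite start_foldl.
  exists p; split.
  - split=> //; first by rewrite sp.
    + by move=> s' hs'; apply: hs; rewrite mem_rcons inE hs' orbT.
    + by rewrite sp.
  - by rewrite /p stop_foldl.
  - by apply: hs; rewrite mem_rcons mem_head.
  - by rewrite eq -cats1 foldl_cat.
move=> [p [[hp hs ep] e hh ->]]; split.
- rewrite rcons_path; apply/andP; split=> //.
  by rewrite -stop_foldl // -ep e.
- by move=> s'; rewrite mem_rcons inE => /orP[/eqP ->|/hs].
- by rewrite -cats1 foldl_cat [in LHS]ep.
Qed.
End Decomposition.

(** * States reached node by node *)

Section States.
Context {R : realType} (I : instance R).
Local Notation V := (vertex I).
Implicit Types (p s u N : nodes I) (x y v : V) (l : seq V) (z : R * R)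
  (t b : R).

(** Driving the subpath s with departure at time t and battery b ends in the
    state z, a pair of a time and a battery level.  The inner time windows are
    only taken into account through [Tstart_max]. *)
Definition leg s t b z : Prop :=
  [/\ t <= Tstart_max s, energy_use s <= b,
      z = (Num.max (t + travel_time s) (Tend_min_sub s), b - energy_use s)
    & z.1 <= horizon I].

(** d is an admissible charging time at the end of p. *)
Definition charging_time p (d : R) : Prop :=
  0 <= d /\ (stop p \notin stations I -> d = 0).

Lemma noncustomer_window v : noncustomer v ->
  tw_open v = 0 /\ tw_close v = horizon I.
Proof. by rewrite noncustomerE => /depot_station_data[]. Qed.

Lemma leg_ge0 s t b z : along_arcs s -> leg s t b z ->
  t <= z.1 /\ 0 <= z.2 <= b.
Proof.
move=> a [_ hE -> _] /=; rewrite subr_ge0 hE lerBlDr lerDl energy_use_ge0 //.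
by rewrite le_max lerDl travel_time_ge0.
Qed.

(** z is the state at the end of p for some charging times that are feasible
    node by node; the load is left out. *)
Definition reaches p z : Prop := exists tau : nat -> R,
  [/\ forall k, 0 <= tau k,
      forall k, node p k \notin stations I -> tau k = 0,
      forall k, (k <= arcs_nb p)%N -> 0 <= path_battery p tau k <= battery I
        /\ tw_open (node p k) <= path_time p tau k <= tw_close (node p k)
    & z = (path_time p tau (arcs_nb p), path_battery p tau (arcs_nb p))].

Lemma feasible_pathE p : feasible_path p <->
  [/\ partial_path p, load p <= capacity I & exists z, reaches p z].
Proof.
split=> [[pp [tau [t0 ts [hl h]]]]|[pp hl [z [tau [t0 ts h _]]]]].
  by split=> //; eexists; exists tau; split.
by split=> //; exists tau; split.
Qed.

(** States depend only on the nodes up to the present one and on the earlier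
    charging times. *)
Lemma path_state_local p p' (tau tau' : nat -> R) k :
  (forall j, (j <= k)%N -> node p j = node p' j) ->
  (forall j, (j < k)%N -> tau j = tau' j) ->
  path_time p tau k = path_time p' tau' k /\
  path_battery p tau k = path_battery p' tau' k.
Proof.
elim: k => [//|k IH] hn ht /=.
have [|j jk|-> ->] := IH; [by move=> j jk; apply: hn;
  exact: leqW|exact/ht/ltnW|].
by rewrite !hn // !ht.
Qed.

Lemma path_state_concatr p s (tau : nat -> R) k :
  stop p = start s -> subpath s ->
  (forall j, (0 < j < size s.2)%N -> tau (size p.2 + j)%N = 0) ->
  (k < size s.2)%N ->
  let m := size p.2 in
  let q := concat p s in
  path_time q tau (m + k.+1) = sub_time s (path_time q tau m + tau m) k.+1 /\
  path_battery q tau (m + k.+1) =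
  sub_battery s (if stop p \in stations I
                 then gC I (path_battery q tau m) (tau m)
                 else path_battery q tau m) k.+1.
Proof.
move=> e hs ht ks m q; elim: k ks => [|k IH] ks.
  rewrite addn1 /= -addn1 !node_concatr ?(ltnW ks) // -node_stop.
  by rewrite -[m in node q m]addn0 node_concatr // node_stop e.
have [IH1 IH2] := IH (ltnW ks).
have E1 : path_time q tau (m + k.+2) =
  Num.max (path_time q tau (m + k.+1) + tau (m + k.+1)%N
            + travel (node q (m + k.+1)) (node q (m + k.+2)))
          (tw_open (node q (m + k.+2))).
  by rewrite (addnS m k.+1).
have E2 : path_battery q tau (m + k.+2) =
  (if node q (m + k.+1) \in stations I
   then gC I (path_battery q tau (m + k.+1)) (tau (m + k.+1)%N)
   else path_battery q tau (m + k.+1))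
  - energy (node q (m + k.+1)) (node q (m + k.+2)).
  by rewrite (addnS m k.+1).
have ht' : tau (m + k.+1)%N = 0 by apply: ht.
have nS : node s k.+1 \notin stations I.
  by apply: customer_not_station; apply: subpath_inner_customer.
by rewrite E1 E2 !node_concatr ?(ltnW ks) // IH1 IH2 ht' addr0 (negPf nS).
Qed.

Lemma reaches_range p z : reaches p z -> 0 <= z.1 /\ 0 <= z.2 <= battery I.
Proof.
move=> [tau [_ _ h ->]] /=; have [hb /andP[ht _]] := h _ (leqnn _); split=> //.
by apply: le_trans ht; have [/andP[]] := time_window (node p (arcs_nb p)).
Qed.

Lemma reaches_nil v z : v \in depots I ->
  reaches ((v, [::]) : nodes I) z <-> z = (0, battery I).
Proof.
move=> vd; have [o c] := noncustomer_window (depot_noncustomer vd).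
have hB : 0 <= battery I <= battery I by rewrite lexx battery_ge0.
have hH : (0 : R) <= 0 <= horizon I.
  by rewrite lexx /=; have := open_le_close v; rewrite o c.
split=> [[tau [_ _ _ ->]] //|->].
exists (fun=> 0); split=> // -[|k] // _.
by split=> //; rewrite /node /= o c.
Qed.

(** The states of p followed by s are obtained from those of p by charging and
    driving s.  At a depot the charging time is 0, and [gC] with no charging is
    the identity, hence the uniform statement. *)
Lemma reaches_concat p s z : subpath s -> (0 < size s.2)%N ->
  stop p = start s ->
  reaches (concat p s) z <->
  exists (y : R * R) (d : R), [/\ reaches p y, charging_time p d, timely s 0
    & leg s (y.1 + d) (gC I y.2 d) z].
Proof.
move=> hs s0 e; have [sa ns1 ns2 _] := subpathP hs.
have [o1 c1] := noncustomer_window ns1; have [o2 c2] := noncustomer_window ns2.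
set q := concat p s; set m := size p.2.
have nbE : arcs_nb q = (m + size s.2)%N by rewrite arcs_nb_concat.
have inS j : (0 < j < size s.2)%N -> node s j \notin stations I.
  by move=> hj; apply: customer_not_station; exact: subpath_inner_customer.
have nodem : node q m = stop p by rewrite node_concatl // node_stop.
have cE d b : 0 <= b <= battery I -> charging_time p d ->
    (if stop p \in stations I then gC I b d else b) = gC I b d.
  by move=> hb [_ hd]; case: ifP => // st; rewrite hd ?st // gC0.
have tim d : 0 <= d -> timely s d <-> d <= Tstart_max s /\ timely s 0.
  by move=> d0; rewrite timelyE o1.
split.
  move=> [tau [t0 ts h ->]].
  pose d := tau m.
  have cd : charging_time p d by split=> [|st]; [exact: t0|apply: ts;
    rewrite nodem].
  (* the charging time at the end of p is accounted for by d *)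
  pose tau' k := if (k < m)%N then tau k else 0.
  have loc k : (k <= m)%N -> path_time p tau' k = path_time q tau k /\
      path_battery p tau' k = path_battery q tau k.
    move=> km; apply: path_state_local => j jk.
      by rewrite node_concatl // (leq_trans jk).
    by rewrite /tau' (leq_trans jk km).
  have [Lt Lb] := loc m (leqnn m).
  have r : reaches p (path_time q tau m, path_battery q tau m).
    exists tau'; split; rewrite ?Lt ?Lb //.
    - by move=> k; rewrite /tau'; case: ifP.
    - move=> k nk; rewrite /tau'; case: ifP => // km; apply: ts.
      by rewrite node_concatl // ltnW.
    - move=> k km; have [-> ->] := loc _ km.
      rewrite -(node_concatl s) //; apply: h; rewrite nbE.
      exact: leq_trans km (leq_addr _ _).
  have [/= y1 y2] := reaches_range r.
  have htau j : (0 < j < size s.2)%N -> tau (m + j)%N = 0.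
    move=> hj; apply: ts; rewrite node_concatr //; first exact: inS.
    by case/andP: hj => _ /ltnW.
  pose t := path_time q tau m + d; pose b := gC I (path_battery q tau m) d.
  have st k : (k < size s.2)%N ->
    path_time q tau (m + k.+1) = sub_time s t k.+1 /\
      path_battery q tau (m + k.+1) = sub_battery s b k.+1.
    move=> ks; have [h1 h2] := path_state_concatr e hs htau ks.
    by rewrite h1 h2 -/m -/q -/d cE.
  have ends : path_time q tau (arcs_nb q) = sub_time s t (size s.2) /\
      path_battery q tau (arcs_nb q) = sub_battery s b (size s.2).
    by rewrite nbE -(prednK s0); apply: st; rewrite prednK.
  have win k : (0 < k <= size s.2)%N -> sub_time s t k <= tw_close (node s k).
    move=> /andP[k0 ks]; have [h1 _] := st k.-1 ltac:(by rewrite prednK).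
    rewrite -(prednK k0) -h1 prednK // -(node_concatr e ks).
    by have [|_ /andP[]] := h (m + k)%N; first by rewrite nbE leq_add2l.
  have tge : 0 <= t by rewrite addr_ge0 // (proj1 cd).
  have tl : timely s t.
    move=> [_|k ks]; last exact: win.
    (* a departure after the horizon would make the first arrival late *)
    rewrite /= node0 c1; apply: le_trans (_ : sub_time s t 1 <= _).
      rewrite /= le_max lerDl; apply/orP; left; apply: ltW; apply: travel_gt0.
      exact: arc_node.
    apply: le_trans (win 1%N _) _ => //.
    by have [_] := time_window (node s 1).
  have [tl1 tl2] := proj1 (tim _ tge) tl.
  have [e1 e2] := ends.
  have se : sub_time s t (size s.2)
    = Num.max (t + travel_time s) (Tend_min_sub s).
    by apply: sub_time_end; rewrite o1.
  exists (path_time q tau m, path_battery q tau m), d; split=> //;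
    rewrite e1 e2.
  have be : sub_battery s b (size s.2)
    = b - energy_use s by exact: sub_batteryE.
  split=> //=; last first.
  - apply: le_trans (win _ _) _; first by rewrite s0 leqnn.
    by have [_] := time_window (node s (size s.2)).
  - by rewrite se be.
  rewrite -subr_ge0 -be -e2; by have [/andP[]] := h _ (leqnn (arcs_nb q)).
move=> [y [d [[tau [t0 ts h ey]] cd tl lg]]].
have ry : reaches p y by exists tau; split.
have [y1 y2] := reaches_range ry.
have [d0 dS] := cd.
pose tau' k := if (k < m)%N then tau k else if k == m then d else 0.
have loc k : (k <= m)%N -> path_time q tau' k = path_time p tau k /\
      path_battery q tau' k = path_battery p tau k.
  move=> km; apply: path_state_local => j jk.
    by rewrite node_concatl // (leq_trans jk).
  by rewrite /tau' (leq_trans jk km).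
have [Lt Lb] := loc m (leqnn m).
have taum : tau' m = d by rewrite /tau' ltnn eqxx.
have htau j : (0 < j < size s.2)%N -> tau' (m + j)%N = 0.
  move=> /andP[j0 _]; rewrite /tau' ltnNge leq_addr /=.
  by rewrite -[X in _ == X]addn0 eqn_add2l eqn0Ngt j0.
pose t := y.1 + d; pose b := gC I y.2 d.
have hb : 0 <= b <= battery I by exact: gC_range.
have st k : (k < size s.2)%N ->
  path_time q tau' (m + k.+1) = sub_time s t k.+1 /\
      path_battery q tau' (m + k.+1) = sub_battery s b k.+1.
  move=> ks; have [h1 h2] := path_state_concatr e hs htau ks.
  rewrite h1 h2 -/m -/q taum Lt Lb /t /b ey /= cE //.
  by move: y2; rewrite ey.
case: lg => [l1 l2 l3 l4].
have tge : 0 <= t by rewrite addr_ge0.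
have tl' : timely s t by apply/tim.
have win := proj2 (sub_battery_range sa hb) l2.
exists tau'; split.
- by move=> k; rewrite /tau'; do 2?[case: ifP => // _].
- move=> k nk; rewrite /tau'; case: ltnP => km.
    by apply: ts; rewrite -(node_concatl s) // ltnW.
  by case: eqP => // ek; apply: dS; rewrite -nodem -ek.
- move=> k; rewrite nbE => ks; case: (leqP k m) => km.
    have [-> ->] := loc _ km; rewrite node_concatl //; exact: h.
  have kE : k = (m + (k - m).-1.+1)%N by rewrite prednK ?subn_gt0 //
    subnKC // ltnW.
  have ks' : ((k - m).-1 < size s.2)%N by rewrite prednK ?subn_gt0 // leq_subLR.
  rewrite kE; have [-> ->] := st _ ks'; rewrite node_concatr //.
  by split; [exact: win|rewrite tl' // sub_time_ge_open // o1].
- have s1 : ((size s.2).-1 < size s.2)%N by rewrite prednK.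
  have [e1 e2] := st _ s1; rewrite prednK // in e1 e2.
  have se : sub_time s t (size s.2)
    = Num.max (t + travel_time s) (Tend_min_sub s).
    by apply: sub_time_end; rewrite o1.
  have be : sub_battery s b (size s.2)
    = b - energy_use s by exact: sub_batteryE.
  by rewrite nbE e1 e2 l3 se be.
Qed.
End States.

(** * States of schedules, and the best one *)

Section Schedules.
Context {R : realType} (I : instance R).
Implicit Types (p q s u N : nodes I) (ss : seq (nodes I)) (y z : R * R)
  (t b d : R).

(** z is the final state of a schedule with the subpaths ss; q only serves as
    the default value of [nth]. *)
Definition sched_state q ss z : Prop := exists tau Ts Te Bs Be,
  schedule q ss tau Ts Te Bs Be /\ z = (Te (size ss).-1, Be (size ss).-1).

Lemma schedulableE p z :
  schedulable p z <-> exists ss, decomposition ss p /\ sched_state p ss z.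
Proof.
split=> [[ss [tau [Ts [Te [Bs [Be [h1 h2 h3]]]]]]]|
         [ss [h1 [tau [Ts [Te [Bs [Be [h2 h3]]]]]]]]].
  by exists ss; split=> //; exists tau, Ts, Te, Bs, Be.
by exists ss, tau, Ts, Te, Bs, Be; split.
Qed.

Lemma sched_state1 q s z : along_arcs s ->
  sched_state q [:: s] z <-> leg s 0 (battery I) z.
Proof.
move=> sa; split.
  move=> [tau [Ts [Te [Bs [Be [[[T0 B0] /(_ 0%N isT) [h1 h2 h3] _ hH /(_ 0%N
    isT) [_ _ _ h4]] ->]]]]]].
  rewrite /= in h1 h2 h3 h4 *; rewrite T0 B0 in h1 h2 h3.
  by split=> //; [rewrite -subr_ge0 -h3|rewrite h2 h3].
move=> lg; have [g1 /andP[g2 _]] := leg_ge0 sa lg; case: lg => l1 l2 l3 l4.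
exists (fun=> 0), (fun=> 0), (fun=> z.1), (fun=> battery I), (fun=> z.2);
  split; last by case: (z).
split=> //.
  by move=> [|//] _ /=; rewrite l3.
by move=> [|//] _ /=; split=> //; exact: battery_ge0.
Qed.

(** The charging time d before the last subpath is the time from its
    predecessor's end to its start; conversely a schedule is extended by one
    more subpath in [sched_state_rcons_inv]. *)
Lemma sched_state_rcons q q' ss s z :
  (0 < size ss)%N -> along_arcs s -> Tstart_max s <= horizon I ->
  sched_state q (rcons ss s) z ->
  exists y d, [/\ sched_state q' ss y, 0 <= d & leg s (y.1 + d) (gC I y.2 d) z].
Proof.
move=> ss0 sa TH [tau [Ts [Te [Bs [Be [[[T0 B0] h2 h3 hH h5] ez]]]]]].
rewrite size_rcons /= in h2 h3 hH h5 ez.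
set m := size ss in ss0 h2 h3 hH h5 ez.
have mE : m.-1.+1 = m by rewrite prednK.
have nthE k : (k < m)%N -> nth q (rcons ss s) k = nth q' ss k.
  by move=> km; rewrite nth_rcons km; exact: set_nth_default.
have nthm : nth q (rcons ss s) m = s by rewrite nth_rcons ltnn eqxx.
have [a1 a2 a3] := h2 m (ltnSn m); rewrite nthm in a1 a2 a3.
have [b1 b2 b3] := h3 m.-1 ltac:(by rewrite mE); rewrite mE in b2 b3.
exists (Te m.-1, Be m.-1), (tau m.-1); split=> //=.
  exists tau, Ts, Te, Bs, Be; split=> //; split=> //.
  - by move=> k km; rewrite -nthE //; apply: h2; exact: leqW.
  - by move=> k km; apply: h3; exact: leqW.
  - by move: a1; rewrite b2 -/m; lra.
  - by move=> k km; apply: h5; exact: leqW.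
rewrite -b2 -b3; split=> //.
- by have [_ _ _] := h5 m (ltnSn m); rewrite a3 subr_ge0.
- by rewrite ez a2 a3.
- by rewrite ez; exact: hH.
Qed.

Lemma sched_state_rcons_inv q q' ss s y d z :
  (0 < size ss)%N -> along_arcs s -> 0 <= y.1 -> 0 <= y.2 <= battery I ->
  sched_state q' ss y -> 0 <= d -> leg s (y.1 + d) (gC I y.2 d) z ->
  sched_state q (rcons ss s) z.
Proof.
move=> ss0 sa y1 y2 [tau [Ts [Te [Bs [Be [[[T0 B0] h2 h3 hH h5] ey]]]]]] d0 lg.
set m := size ss in ss0 h2 h3 hH h5 ey.
have mE : m.-1.+1 = m by rewrite prednK.
have nthE k : (k < m)%N -> nth q (rcons ss s) k = nth q' ss k.
  by move=> km; rewrite nth_rcons km; exact: set_nth_default.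
have nthm : nth q (rcons ss s) m = s by rewrite nth_rcons ltnn eqxx.
have [g1 /andP[g2 g3]] := leg_ge0 sa lg; case: lg => l1 l2 l3 l4.
pose upd (f : nat -> R) n v k := if k == n then v else f k.
have updE f n v : upd f n v n = v by rewrite /upd eqxx.
have updN f n v k : (k < n)%N -> upd f n v k = f k by move=> kn;
  rewrite /upd ltn_eqF.
exists (upd tau m.-1 d), (upd Ts m (y.1 + d)), (upd Te m z.1),
  (upd Bs m (gC I y.2 d)), (upd Be m z.2).
split; last by rewrite size_rcons /= !updE; case: (z).
have step k : (k < m.+1)%N -> (k = m) \/ (k < m)%N.
  by rewrite ltnS leq_eqVlt => /orP[/eqP|]; [left|right].
split; rewrite ?size_rcons //=.
- by rewrite !updN.
- move=> k /step[->|km]; first by rewrite nthm !updE l3.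
  by rewrite nthE // !updN //; exact: h2.
- move=> k; rewrite ltnS => km; have [kE|km'] : k.+1 = m \/ (k.+1 < m)%N.
    by move: km; rewrite leq_eqVlt => /orP[/eqP|]; [left|right].
    have ek : k = m.-1 by rewrite -kE.
    rewrite kE !updE ek updE !updN ?mE //.
    by rewrite ey.
  rewrite !updN //; [exact: h3|by rewrite -ltnS mE].
- by rewrite -/m updE.
- move=> k /step[->|km]; last by rewrite !updN //; exact: h5.
  have yd : 0 <= y.1 + d by rewrite addr_ge0.
  by rewrite !updE; split=> //; [exact: le_trans yd g1|exact: le_trans g2 g3].
Qed.

(** The states of p, with the convention for single nodes made in
    [Tend_min_path] and [Bend_max_path]. *)
Definition scheduled p z : Prop :=
  if p.2 is [::] then z = (0, battery I) else schedulable p z.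

Lemma Tstart_max_le_horizon s : Tstart_max s <= horizon I.
Proof.
apply: le_trans (latest_start_le _ _) _; by have [_] := time_window (s.1).
Qed.

Lemma concat_nonempty p s : (0 < size s.2)%N -> (concat p s).2 <> [::].
Proof.
by move=> s0 /(congr1 size); rewrite /= size_cat; case: size s0 => // n;
  rewrite addnS.
Qed.

Lemma scheduledE p z : p.2 <> [::] -> scheduled p z <-> schedulable p z.
Proof. by rewrite /scheduled; case: p.2. Qed.

Lemma decomposition_concat_inv ss p s : subpath s -> (0 < size s.2)%N ->
  stop p = start s ->
  decomposition ss (concat p s) ->
    exists ss', ss = rcons ss' s /\ decomposition ss' p.
Proof.
move=> hs s0 e; case/lastP: ss => [|ss s'].
  by case=> _ _ /= h; case: (concat_nonempty (p := p) s0); rewrite h.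
move/decomposition_rcons => [p' [dp e' [hs' s'0] ee]].
have [-> ->] := concat_inj hs hs' s0 s'0 e e' ee.
by exists ss.
Qed.

Lemma decomposition_nil p ss : decomposition ss p -> (p.2 = [::] <-> ss = [::]).
Proof.
case/lastP: ss => [[_ _ ->] //|ss s].
move/decomposition_rcons => [p' [_ _ [_ s0] ->]];
  split=> [/(concat_nonempty s0) //|].
by case: ss.
Qed.

Lemma scheduled_concat_inv p s z : partial_path p -> subpath s ->
  (0 < size s.2)%N ->
  extends_path p s -> scheduled (concat p s) z ->
  exists y d, [/\ scheduled p y, charging_time p d
    & leg s (y.1 + d) (gC I y.2 d) z].
Proof.
move=> pp hs s0 [e st]; have [sa _ _ _] := subpathP hs.
have [_ pd _ _] := partial_pathP pp.
rewrite (scheduledE _ (concat_nonempty s0)) => /schedulableE [ss [dc sc]].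
have [ss' [ess dp]] := decomposition_concat_inv hs s0 e dc; subst ss.
have [p0|p0] := eqVneq p.2 [::].
  have ss0 : ss' = [::] by apply/(decomposition_nil dp).
  rewrite ss0 in sc; move/(sched_state1 _ _ sa): sc => sc.
  exists (0, battery I), 0; rewrite /= add0r gC0 ?lexx ?battery_ge0 //;
    split=> //.
  by rewrite /scheduled p0.
have ss0 : (0 < size ss')%N.
  rewrite lt0n; apply/eqP => /size0nil h.
  by move/eqP: p0; case; apply/(decomposition_nil dp).
have [y [d [h1 d0 lg]]] := sched_state_rcons p ss0 sa (Tstart_max_le_horizon s)
  sc.
exists y, d; split=> //; last first.
  by split=> // nst; case: st => [st|[h _]];
    [rewrite st in nst|rewrite h in p0].
apply/scheduledE; first exact/eqP.
by apply/schedulableE; exists ss'.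
Qed.

Lemma scheduled_range p z : partial_path p -> scheduled p z ->
  0 <= z.1 /\ 0 <= z.2 <= battery I.
Proof.
move=> pp; move: p pp z; apply: partial_path_ind.
  by move=> v _ z ->; rewrite /= lexx battery_ge0 lexx.
move=> p s pp ex hs s0 IH z.
move/(scheduled_concat_inv pp hs s0 ex) => [y [d [/IH [y1 y2] [d0 _] lg]]].
have [sa _ _ _] := subpathP hs.
have [g1 /andP[g2 g3]] := leg_ge0 sa lg; split.
  by apply: le_trans g1; rewrite addr_ge0.
by rewrite g2 (le_trans g3) //; case/andP: (gC_range y2 d0).
Qed.

Lemma scheduled_concat p s y d z : partial_path p -> subpath s ->
  (0 < size s.2)%N ->
  extends_path p s -> scheduled p y -> charging_time p d ->
  leg s (y.1 + d) (gC I y.2 d) z -> scheduled (concat p s) z.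
Proof.
move=> pp hs s0 [e st] sy [d0 dS] lg; have [sa _ _ _] := subpathP hs.
have [y1 y2] := scheduled_range pp sy.
apply/(scheduledE _ (concat_nonempty s0))/schedulableE.
have [p0|p0] := eqVneq p.2 [::].
  have pd : start p \in depots I by case/partial_pathP: pp.
  have nst : stop p \notin stations I.
    by move: pd; rewrite /stop p0 => /depot_not_station.
  move: sy; rewrite /scheduled p0 => ey.
  exists [:: s]; split; last first.
    by apply/sched_state1 => //; move: lg;
      rewrite ey dS // addr0 gC0 // lexx battery_ge0.
  apply/(@decomposition_rcons R I [::]); exists p; split=> //.
  by split=> //; move: p0; case: (p) => ? ? /= ->.
move: sy; rewrite scheduledE; last exact/eqP.
move/schedulableE => [ss [dp sc]].
have ss0 : (0 < size ss)%N.
  rewrite lt0n; apply/eqP => /size0nil h.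
  by move/eqP: p0; case; apply/(decomposition_nil dp).
exists (rcons ss s); split; first by apply/decomposition_rcons; exists p.
exact: (sched_state_rcons_inv _ ss0 sa y1 y2 sc d0 lg).
Qed.

(** For a path that can be driven at all, charging times that are feasible node
    by node and schedules lead to the same states.  The hypothesis is needed
    because schedules do not check that the subpaths are feasible. *)
Lemma reaches_scheduled p : partial_path p -> (exists z, reaches p z) ->
  forall z, reaches p z <-> scheduled p z.
Proof.
move: p; apply: partial_path_ind; first by move=> v vd _ z; exact: reaches_nil.
move=> p s pp ex hs s0 IH [z0 /(reaches_concat _ hs s0 (proj1 ex)) [y0 [d0 [r0
  _ ts _]]]] z.
rewrite reaches_concat //; last by case: ex.
have {}IH := IH (ex_intro _ _ r0).
split=> [[y [d [/IH h cd _ lg]]]|]; first exact: scheduled_concat h cd lg.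
move/(scheduled_concat_inv pp hs s0 ex) => [y [d [/IH h cd lg]]].
by exists y, d.
Qed.

(** The domination relation of states: y is no later than z, and the time
    between them suffices to charge from the level of y to that of z. *)
Definition better y z : Prop :=
  y.1 <= z.1 /\ charge_inv I z.2 + y.1 <= charge_inv I y.2 + z.1.

Lemma better_trans y z w : better y z -> better z w -> better y w.
Proof. by rewrite /better => -[h1 h2] [h3 h4]; split; lra. Qed.

Lemma better_refl y : better y y.
Proof. by split. Qed.

Lemma better_le y z : 0 <= y.2 <= battery I -> 0 <= z.2 <= battery I ->
  y.1 <= z.1 -> z.2 <= y.2 -> better y z.
Proof.
by move=> hy hz h1 h2; split=> //; have := charge_inv_mono hz hy h2; lra.
Qed.

Lemma better_charge y z d : 0 <= y.2 <= battery I ->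
  0 <= z.2 <= battery I -> 0 <= d ->
  better y z -> gC I z.2 d <= gC I y.2 (z.1 + d - y.1).
Proof.
move=> hy hz d0 [h1 h2]; rewrite /gC; apply: charge_nondecreasing; last lra.
by rewrite addr_ge0 // charge_inv_ge0.
Qed.

(** A state of p that dominates all states of p. *)
Definition best_state p z : Prop := scheduled p z /\ forall w,
  scheduled p w -> better z w.

(** Starting from a better state, one can depart at the same time with at least
    the same battery. *)
Lemma leg_better s y1 y2 d w : along_arcs s -> 0 <= y1.2 <= battery I ->
  0 <= y2.2 <= battery I -> 0 <= d -> better y1 y2 ->
  leg s (y2.1 + d) (gC I y2.2 d) w ->
  exists d' v, [/\ 0 <= d', leg s (y1.1 + d') (gC I y1.2 d') v & better v w].
Proof.
move=> sa r1 r2 d0 b lg; have gle := better_charge r1 r2 d0 b.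
have [_ /andP[w0 wle]] := leg_ge0 sa lg; case: lg => l1 l2 l3 l4.
have d'0 : 0 <= y2.1 + d - y1.1 by case: b => b1 _; move: b1 d0; lra.
have E : y1.1 + (y2.1 + d - y1.1) = y2.1 + d by rewrite addrC subrK.
exists (y2.1 + d - y1.1), (w.1, gC I y1.2 (y2.1 + d - y1.1) - energy_use s).
have /andP[g0 gB] := gC_range r1 d'0.
have le : w.2 <= gC I y1.2 (y2.1 + d - y1.1) - energy_use s.
  by rewrite l3 /= lerD2r.
split=> //; first by rewrite E; split=> //; [exact: le_trans gle|rewrite l3].
apply: better_le => //=; rewrite ?w0 ?(le_trans w0 le) /=.
  by rewrite lerBlDr (le_trans gB) // lerDl energy_use_ge0.
have /andP[_ gB2] := gC_range r2 d0.
by rewrite (le_trans wle).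
Qed.

(** The largest delay x1 that meets the deadline TL and has the same arrival
    time as the delay m: beyond it, a further delay before the deadline delays
    the arrival as much. *)
Lemma latest_free_delay (m T tr TE TL : R) : T + m <= TL ->
  exists x1, [/\ m <= x1, T + x1 <= TL,
    Num.max (T + x1 + tr) TE = Num.max (T + m + tr) TE
  & forall x, T + x <= TL -> x1 < x ->
      Num.max (T + x + tr) TE = Num.max (T + x1 + tr) TE + (x - x1)].
Proof.
move=> mL; have [le|lt] := leP TE (T + m + tr).
  exists m; split=> //; first by rewrite max_l.
  by move=> x xL mx; rewrite !max_l; lra.
have [hm|hm] := leP (TE - tr) TL.
  exists (TE - tr - T); split; first lra; first lra.
    by rewrite max_r //; lra.
  by move=> x xL mx; rewrite max_l ?max_r; lra.
exists (TL - T); split; first lra; first lra.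
  by rewrite max_r //; lra.
by move=> x xL mx; lra.
Qed.

(** Among the states obtained from y by charging and driving s, one dominates
    all others. *)
Lemma leg_best s y d w : along_arcs s -> 0 <= y.2 <= battery I -> 0 <= d ->
  leg s (y.1 + d) (gC I y.2 d) w ->
  exists d1 h, [/\ 0 <= d1, leg s (y.1 + d1) (gC I y.2 d1) h
    & forall d' v, 0 <= d' -> leg s (y.1 + d') (gC I y.2 d') v -> better h v].
Proof.
case: y => T0 b /= sa r d0 lg; have ci0 := charge_inv_ge0 r.
have E0 := energy_use_ge0 sa; rewrite {r}/gC in lg *.
have mono x x' : 0 <= x -> x <= x' ->
    charge I (charge_inv I b + x) <= charge I (charge_inv I b + x').
  by move=> h1 h2; apply: charge_nondecreasing;
    [rewrite addr_ge0|rewrite lerD2l].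
have cB x : 0 <= x -> charge I (charge_inv I b + x) <= battery I.
  by move=> x0; case/andP: (charge_range I (addr_ge0 ci0 x0)).
case: lg => dL dE -> /= dH0.
have EB : 0 <= energy_use s <= battery I by rewrite E0 (le_trans dE) ?cB.
have Eci x : 0 <= x -> (energy_use s <= charge I (charge_inv I b + x)) =
    (charge_inv I (energy_use s) - charge_inv I b <= x).
  by move=> x0; rewrite -charge_inv_le // ?addr_ge0 // lerBlDl.
(* the least charging time after which s can be driven *)
pose m := Num.max 0 (charge_inv I (energy_use s) - charge_inv I b).
have m0 : 0 <= m by rewrite le_max lexx.
have mmin x : 0 <= x -> energy_use s <= charge I (charge_inv I b + x) -> m <= x.
  by move=> x0; rewrite Eci // ge_max x0.
have [|x1 [mx1 x1L x1m x1max]] :=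
    @latest_free_delay m T0 (travel_time s) (Tend_min_sub s) (Tstart_max s).
  by apply: le_trans dL; rewrite lerD2l mmin.
have x10 := le_trans m0 mx1.
have x1E : energy_use s <= charge I (charge_inv I b + x1).
  by rewrite Eci // (le_trans _ mx1) // le_max lexx orbT.
have early x : 0 <= x -> energy_use s <= charge I (charge_inv I b + x) ->
    Num.max (T0 + x1 + travel_time s) (Tend_min_sub s)
    <= Num.max (T0 + x + travel_time s) (Tend_min_sub s).
  move=> x0 xE; rewrite x1m ge_max !le_max lexx orbT andbT.
  by rewrite lerD2r lerD2l mmin.
exists x1, (Num.max (T0 + x1 + travel_time s) (Tend_min_sub s),
            charge I (charge_inv I b + x1) - energy_use s).
split=> //; first by split=> //=; apply: le_trans dH0; exact: early.
move=> x v x0 [/= xL xE -> _].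
have rng x' : 0 <= x' -> energy_use s <= charge I (charge_inv I b + x') ->
    0 <= charge I (charge_inv I b + x') - energy_use s <= battery I.
  by move=> h0 hE; rewrite subr_ge0 hE lerBlDr (le_trans (cB _ h0)) // lerDl.
have r1 := rng _ x10 x1E; have r := rng _ x0 xE.
have [xle|xgt] := leP x x1.
  by apply: better_le => //=; [exact: early|rewrite lerD2r mono].
split; first exact: early.
rewrite /= (x1max _ xL xgt).
set B1 := charge I (_ + x1) - _ in r1 *; set B2 := charge I (_ + x) - _ in r *.
have dx : 0 <= x - x1 by rewrite subr_ge0 ltW.
have i1 := charge_inv_ge0 r1.
suff : charge_inv I B2 <= charge_inv I B1 + (x - x1).
  by move: (charge_inv I B1) (charge_inv I B2) (Num.max _ _) => *; lra.
rewrite (charge_inv_le r (addr_ge0 i1 dx)).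
have le1 : charge_inv I B1 <= charge_inv I b + x1.
  by rewrite (charge_inv_le r1 (addr_ge0 ci0 x10)) gerBl.
have := charge_slope I i1 le1 dx.
rewrite charge_invK // -addrA [x1 + _]addrC subrK /B1 /B2.
by move: (charge I _) (charge I (_ + x1)) (charge I (_ + (x - x1))) => *; lra.
Qed.

Lemma best_state_concat p s z w : partial_path p -> subpath s ->
  (0 < size s.2)%N ->
  extends_path p s -> p.2 <> [::] -> best_state p z ->
    scheduled (concat p s) w ->
  exists h, best_state (concat p s) h.
Proof.
move=> pp hs s0 ex pn [sz hz] sw; have [sa _ _ _] := subpathP hs.
have [_ z2] := scheduled_range pp sz.
have pst : stop p \in stations I by case: ex => _ [//|[]].
have from_z v : scheduled (concat p s) v -> exists d v',
    [/\ 0 <= d, leg s (z.1 + d) (gC I z.2 d) v' & better v' v].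
  move/(scheduled_concat_inv pp hs s0 ex) => [y [d [sy [d0 _] lg]]].
  have [_ y2] := scheduled_range pp sy;
    exact: (leg_better sa z2 y2 d0 (hz _ sy) lg).
have [d [v [d0 lg _]]] := from_z _ sw.
have [d1 [h [d10 lh best]]] := leg_best sa z2 d0 lg.
exists h; split.
  by apply: scheduled_concat lh => //; split=> //; rewrite pst.
by move=> u /from_z [d' [v' [d'0 lg' b]]]; apply: better_trans b;
  exact: best lg'.
Qed.

Lemma best_state_exists p w : partial_path p -> scheduled p w ->
  exists z, best_state p z.
Proof.
move=> pp; move: p pp w; apply: partial_path_ind.
  move=> v _ _ _; exists (0, battery I); split=> [|w ew] //.
  by rewrite (ew : w = (0, battery I)); exact: better_refl.
move=> p s pp ex hs s0 IH w sw.
have [y [d [sy cd lg]]] := scheduled_concat_inv pp hs s0 ex sw.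
have [p0|p0] := eqVneq p.2 [::]; last first.
  by have [z hz] := IH _ sy; apply: best_state_concat hz sw => //; exact/eqP.
exists w; split=> // v /(scheduled_concat_inv pp hs s0 ex) [y' [d' [sy' cd'
  lg']]].
have pd : start p \in depots I by case/partial_pathP: pp.
have nst : stop p \notin stations I.
  by move: pd; rewrite /stop p0 => /depot_not_station.
move: sy sy' lg lg'; rewrite /scheduled p0 => -> ->.
rewrite (proj2 cd) // (proj2 cd') // => -[_ _ -> _] [_ _ -> _].
exact: better_refl.
Qed.

(** The minimum and the maximum that define [Tend_min_path] and [Bend_max_path]
    are attained, by the best state. *)
Lemma best_state_ends p z : partial_path p -> best_state p z ->
  Tend_min_path p = z.1 /\ Bend_max_path p = z.2.
Proof.
move=> pp [sz hz]; rewrite /Bend_max_path.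
have -> : Tend_min_path p = z.1.
  rewrite /Tend_min_path; move: sz hz; rewrite /scheduled;
    case: p.2 => [-> //|v l] sz hz.
  rewrite /minimum; set A := [set t | _]%classic.
  have Az : (A `&` lbound A)%classic z.1.
    split; first by exists z.2; rewrite -surjective_pairing.
    by move=> t [b /hz[]].
  case: xgetP => [t -> [At lt]|/(_ z.1)//].
  by apply: le_anti; rewrite lt ?(proj2 Az) //; exact: (proj1 Az).
split=> //; move: sz hz (fun w => @scheduled_range p w pp); rewrite /scheduled.
case: p.2 => [-> //|v l] sz hz hr.
rewrite /maximum; set A := [set b | _]%classic.
have Az : (A `&` ubound A)%classic z.2.
  split; first by rewrite /A /= -surjective_pairing.
  move=> b hb; have [/= _ h] := hz _ hb; have [/= _ bB] := hr _ hb.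
  have [_ zB] := hr _ sz.
  rewrite -(charge_invK bB) -(charge_invK zB); apply: charge_nondecreasing.
    exact: charge_inv_ge0.
  by lra.
case: xgetP => [b -> [Ab ub]|/(_ z.2)//].
by apply: le_anti; rewrite ub ?(proj2 Az) //; exact: (proj1 Az).
Qed.

Lemma best_state_dominates p1 p2 z1 z2 : partial_path p1 -> partial_path p2 ->
  best_state p1 z1 -> best_state p2 z2 ->
  Tend_min_path p1
  + gT I (Bend_max_path p1) (Num.max (Bend_max_path p1) (Bend_max_path p2))
  <= Tend_min_path p2 <-> better z1 z2.
Proof.
move=> pp1 pp2 h1 h2.
have [-> ->] := best_state_ends pp1 h1; have [-> ->] := best_state_ends pp2 h2.
have [_ b1] := scheduled_range pp1 (proj1 h1).
have [_ b2] := scheduled_range pp2 (proj1 h2).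
rewrite /gT /better; case: (leP z1.2 z2.2) => [le|lt].
  have := charge_inv_mono b1 b2 le; split; [split|case]; lra.
have := charge_inv_mono b2 b1 (ltW lt); split; [split|case]; lra.
Qed.
End Schedules.

(** * Domination of paths *)

Section PathDomination.
Context {R : realType} (I : instance R) (P : pricing I).
Implicit Types (p q s : nodes I) (y z v w : R * R).

Lemma dominates_path_refl p : dominates_path P p p.
Proof.
split=> //; last by rewrite maxxx /gT subrr addr0.
by rewrite /rcost_dominates subrr big1 // => c _; rewrite ltxx mulr0.
Qed.

(** For the resource part of path domination it suffices that each state of the
    dominated path is dominated by some state of the other. *)
Lemma dominates_path_states q1 q2 : partial_path q1 -> partial_path q2 ->
  start q1 = start q2 -> stop q1 = stop q2 -> rcost_dominates P q1 q2 ->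
  load q1 <= load q2 -> (exists w, scheduled q2 w) ->
  (forall w, scheduled q2 w -> exists v, scheduled q1 v /\ better I v w) ->
  dominates_path P q1 q2.
Proof.
move=> pq1 pq2 es ee hr hl [w sw] sim.
have [z2 [s2 h2]] := best_state_exists pq2 sw.
have [v [sv bv]] := sim _ s2.
have [z1 [s1 h1]] := best_state_exists pq1 sv.
split=> //; apply/(best_state_dominates (z1 := z1) (z2 := z2)) => //.
exact: better_trans (h1 _ sv) bv.
Qed.

Lemma concat0 p s : s.2 = [::] -> concat p s = p.
Proof. by case: s => x l /= ->; exact: concat_nil. Qed.

Lemma feasible_path_concat p s v : feasible_path p -> feasible_subpath s ->
  (0 < size s.2)%N -> extends_path p s -> load p + load s <= capacity I ->
  scheduled (concat p s) v -> feasible_path (concat p s).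
Proof.
move=> /feasible_pathE [pp _ rp] [hs /feasible_partial_subpathE [_ _ _ ts]] s0
  ex hl sv.
have [_ ns _ _] := subpathP hs; have [e _] := ex.
apply/feasible_pathE; split;
  [exact: partial_path_concat|by rewrite load_concat|].
have [y [d [sy cd lg]]] := scheduled_concat_inv pp hs s0 ex sv.
exists v; apply/reaches_concat => //; exists y, d; split=> //.
  exact/(reaches_scheduled pp rp).
by have [<- _] := noncustomer_window ns.
Qed.

Lemma feasible_concat_scheduled p s : feasible_path p -> subpath s ->
  (0 < size s.2)%N -> extends_path p s -> feasible_path (concat p s) ->
  [/\ partial_path (concat p s), load p + load s <= capacity I
    & exists v, scheduled (concat p s) v].
Proof.
move=> fp hs s0 ex /feasible_pathE [pp hl rp].
have [_ ns _ _] := subpathP hs.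
split=> //; first by rewrite -load_concat.
by have [v rv] := rp; exists v; apply/(reaches_scheduled pp rp).
Qed.

Lemma path_extension_dominates p1 p2 s :
  feasible_path p1 -> feasible_path p2 -> dominates_path P p1 p2 ->
  feasible_subpath s -> extends_path p1 s -> extends_path p2 s ->
  feasible_path (concat p2 s) ->
  feasible_path (concat p1 s) /\ dominates_path P (concat p1 s) (concat p2 s).
Proof.
move=> f1 f2 D fs ex1 ex2 fc.
have [s0|s0] := posnP (size s.2).
  by rewrite !concat0 // ?(size0nil s0).
have [hs _] := fs; have [sa ns _ _] := subpathP hs.
have [pp1 _ r1] := proj1 (feasible_pathE _) f1.
have [pp2 _ r2] := proj1 (feasible_pathE _) f2.
have [st|nst] := boolP (stop p1 \in stations I); last first.
  (* both paths reduce to the same depot *)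
  suff -> : p1 = p2 by split=> //; exact: dominates_path_refl.
  case: D => -[es ee] _ _ _.
  case: (ex1) => _ [st|[p10 _]]; first by rewrite st in nst.
  case: (ex2) => _ [st|[p20 _]]; first by rewrite ee st in nst.
  by move: es p10 p20; case: (p1) => ? ?; case: (p2) => ? ?;
    rewrite /start /= => -> -> ->.
have [pc2 l2 [w sw]] := feasible_concat_scheduled f2 hs s0 ex2 fc.
case: (D) => -[es ee] hr hl hT.
have [z1 [sz1 hz1]] : exists z, best_state p1 z.
  by have [v rv] := r1; apply: (@best_state_exists _ _ p1 v) => //;
    apply/reaches_scheduled => //; exists v.
have [z2 [sz2 hz2]] : exists z, best_state p2 z.
  by have [v rv] := r2; apply: (@best_state_exists _ _ p2 v) => //;
    apply/reaches_scheduled => //; exists v.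
have b12 : better I z1 z2 by apply/(best_state_dominates pp1 pp2).
have sim u : scheduled (concat p2 s) u ->
    exists v, scheduled (concat p1 s) v /\ better I v u.
  move=> /(scheduled_concat_inv pp2 hs s0 ex2) [y [d [sy [d0 _] lg]]].
  have [_ ry] := scheduled_range pp2 sy; have [_ rz] := scheduled_range pp1 sz1.
  have b := better_trans b12 (hz2 _ sy).
  have [d' [v [d'0 lg' b']]] := leg_better sa rz ry d0 b lg.
  exists v; split=> //; apply: scheduled_concat lg' => //.
  by split=> //; rewrite st.
have [v [sv _]] := sim _ sw.
split.
  apply: feasible_path_concat sv => //; apply: le_trans l2.
  by rewrite lerD2r.
have [e1 _] := ex1; have [e2 _] := ex2.
apply: dominates_path_states => //; first exact: partial_path_concat.
- by rewrite !stop_concat.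
- exact: rcost_dominates_concatr.
- by rewrite !load_concat // lerD2r.
- by exists w.
Qed.

(** A dominating subpath, driven from the same departure, ends in a better
    state. *)
Lemma leg_dominates_sub s1 s2 t b w :
  along_arcs s1 -> along_arcs s2 -> 0 <= b <= battery I ->
  dominates_sub P s1 s2 -> leg s2 t b w ->
  exists v, leg s1 t b v /\ better I v w.
Proof.
move=> a1 a2 /andP[b0 bB] [_ _ [_ hE] [hTE hTL] hQ] [l1 l2 -> l4].
have tle : Num.max (t + travel_time s1) (Tend_min_sub s1)
    <= Num.max (t + travel_time s2) (Tend_min_sub s2).
  rewrite ge_max; apply/andP; split; last by rewrite le_max hTE orbT.
  have : travel_time s1 <= Qspan s2 by apply: le_trans hQ; rewrite le_max lexx.
  rewrite !le_max => /orP[h|h]; apply/orP; first by left; rewrite lerD2l.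
  by right; move: h l1; lra.
have E1 := energy_use_ge0 a1; have E2 := energy_use_ge0 a2.
exists (Num.max (t + travel_time s1) (Tend_min_sub s1), b - energy_use s1);
  split.
  by split=> //; [exact: le_trans hTL|exact: le_trans l2|exact: le_trans l4].
by apply: better_le => //=; lra.
Qed.

Lemma subpath_exchange_dominates s1 s2 p :
  feasible_subpath s1 -> feasible_subpath s2 -> dominates_sub P s1 s2 ->
  feasible_path p -> extends_path p s1 -> extends_path p s2 ->
  feasible_path (concat p s2) ->
  feasible_path (concat p s1) /\ dominates_path P (concat p s1) (concat p s2).
Proof.
move=> fs1 fs2 D fp ex1 ex2 fc.
have [hs1 _] := fs1; have [a1 n1 _ _] := subpathP hs1.
have [hs2 _] := fs2; have [a2 n2 _ _] := subpathP hs2.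
case: (D) => -[es ee] hr [hl hE] _ _.
have [pp plo rp] := proj1 (feasible_pathE _) fp.
have [e1 _] := ex1; have [e2 _] := ex2.
have [s20|s20] := posnP (size s2.2).
  have [s10|s10] := posnP (size s1.2).
    rewrite !concat0 ?(size0nil s10) ?(size0nil s20) //; split=> //.
    exact: dominates_path_refl.
  have := energy_use_gt0 a1 s10; move: hE; rewrite {2}/energy_use.
  move: s20; case: (s2) => x [|//] _; rewrite arc_sum_nil => h1 h2.
  by move: h1 h2; lra.
have [pc2 l2 [w sw]] := feasible_concat_scheduled fp hs2 s20 ex2 fc.
have hr' : rcost_dominates P (concat p s1) (concat p s2).
  by apply: rcost_dominates_concatl => //; rewrite e1.
have hl' : load (concat p s1) <= load (concat p s2).
  by rewrite !load_concat // lerD2l.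
have ee' : stop (concat p s1) = stop (concat p s2) by rewrite !stop_concat.
have [s10|s10] := posnP (size s1.2).
  (* waiting or charging and then driving s2 is worse than staying *)
  have c1 : concat p s1 = p by rewrite concat0 ?(size0nil s10).
  rewrite c1 in hr' hl' ee' *; split=> //.
  apply: dominates_path_states => //; first by exists w.
  move=> u /(scheduled_concat_inv pp hs2 s20 ex2) [y [d [sy [d0 _] lg]]].
  exists y; split=> //.
  have [y1 y2] := scheduled_range pp sy.
  have [g1 /andP[g2 g3]] := leg_ge0 a2 lg.
  have gr := gC_range y2 d0.
  have ur : 0 <= u.2 <= battery I by rewrite g2 (le_trans g3) //; case/andP: gr.
  have i1 := charge_inv_mono ur gr g3; have i2 := charge_inv_gC y2 d0.
  by split; move: d0 g1 i1 i2; lra.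
have sim u : scheduled (concat p s2) u ->
    exists v, scheduled (concat p s1) v /\ better I v u.
  move=> /(scheduled_concat_inv pp hs2 s20 ex2) [y [d [sy cd lg]]].
  have [_ y2] := scheduled_range pp sy.
  have [v [lg' b]] := leg_dominates_sub a1 a2 (gC_range y2 (proj1 cd)) D lg.
  by exists v; split=> //; apply: scheduled_concat lg'.
have [v [sv _]] := sim _ sw.
split.
  apply: feasible_path_concat sv => //; apply: le_trans l2.
  by rewrite lerD2l.
apply: dominates_path_states => //; first exact: partial_path_concat.
by exists w.
Qed.
End PathDomination.

Theorem proposition11 (R : realType) (I : instance R) (P : pricing I) :
  [/\
    forall (s1 s2 : nodes I) (a : vertex I * vertex I),
      feasible_partial_subpath s1 -> feasible_partial_subpath s2 ->
      dominates_sub P s1 s2 ->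
      extends_arc s1 a -> extends_arc s2 a ->
      feasible_partial_subpath (extend_arc s2 a) ->
      feasible_partial_subpath (extend_arc s1 a) /\
      dominates_sub P (extend_arc s1 a) (extend_arc s2 a),
    forall (p1 p2 s : nodes I),
      feasible_path p1 -> feasible_path p2 ->
      dominates_path P p1 p2 ->
      feasible_subpath s ->
      extends_path p1 s -> extends_path p2 s ->
      feasible_path (concat p2 s) ->
      feasible_path (concat p1 s) /\
      dominates_path P (concat p1 s) (concat p2 s)
  & forall (s1 s2 p : nodes I),
      feasible_subpath s1 -> feasible_subpath s2 ->
      dominates_sub P s1 s2 ->
      feasible_path p ->
      extends_path p s1 -> extends_path p s2 ->
      feasible_path (concat p s2) ->
      feasible_path (concat p s1) /\
      dominates_path P (concat p s1) (concat p s2)].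
Proof.
split=> [s1 s2 a|p1 p2 s|s1 s2 p].
- exact: subpath_arc_extension_dominates.
- exact: path_extension_dominates.
- exact: subpath_exchange_dominates.
Qed.
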